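(* Let $T\subset\mathbb{N}=\{1,2,\dots\}$ be finite, let $m\ge1$ be an integer, let $l_i\ge 0$ be integers for $i\in T$, and let $\alpha\in\mathbb{F}_q$. Let $N^*(m,\prod_{i\in T}I_i^{l_i},\langle x+\alpha\rangle)$ be the number of monic polynomials over $\mathbb{F}_q$ of degree $m$ whose coefficient of $x^{m-1}$ is $\alpha$ and which, for each $i\in T$, have exactly $l_i$ monic irreducible factors of degree $i$ counted with multiplicity. Then $$N^*\Big(m,\prod_{i\in T}I_i^{l_i},\langle x+\alpha\rangle\Big)=q^{m-1}\sum_{(j_i)_{i\in T}}\mathbf{1}\Big[\sum_{i\in T}i(l_i+j_i)\le m\Big]\prod_{i\in T}\binom{|I_i|+l_i-1}{l_i}q^{-il_i}\binom{|I_i|}{j_i}(-1)^{j_i}q^{-ij_i}$$ $$\qquad+\frac{v(\alpha)}{q}\sum_{(k_i)_{i\in T}}\mathbf{1}\Big[\sum_{i\in T}i(l_i+k_i)=m\Big]\prod_{i\in T}B_{l_i}(a_i,b_i)A_{k_i}(a_i,b_i)(-1)^{k_i},$$ where the first sum runs over tuples of integers $0\le j_i\le|I_i|$, the second over tuples of integers $k_i\ge0$, and $v(\alpha)=q\,\mathbf{1}[\alpha=0]-1$.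
   Context: $\mathbb{F}_q$ is a finite field with $q=p^e$ elements, $p$ prime, $e\ge1$, and $I_i$ is the set of monic irreducible polynomials of degree $i$ over $\mathbb{F}_q$. For $i\ge1$ put $$a_i=\frac{1}{iq}\sum_{k\mid i,\;p\nmid k}\mu(k)q^{i/k},\qquad b_i=\frac1i\sum_{k\mid i,\;p\mid k}\mu(k)q^{i/k},$$ with $\mu$ the Möbius function; these are integers ($b_i$ may be negative). For integers $k\ge 0$, $a,b$, put, for $b\neq0$, $$A_k(a,b)=\sum_{j=0}^{\lfloor k/p\rfloor}\binom{aq/p}{j}\binom{b}{k-pj}(-1)^{j+pj},\qquad B_k(a,b)=\sum_{j=0}^{\lfloor k/p\rfloor}\binom{aq/p+j-1}{j}\binom{b+k-pj-1}{k-pj},$$ and, for $b=0$, $$A_k(a,0)=\binom{aq/p}{k/p}(-1)^{k+k/p}\,\mathbf{1}[p\mid k],\qquad B_k(a,0)=\binom{aq/p+k/p-1}{k/p}\,\mathbf{1}[p\mid k].$$ Binomial coefficients are generalized: $\binom{x}{n}=x(x-1)\cdots(x-n+1)/n!$ for integers $n\ge0$. $\mathbf{1}[P]$ is $1$ if $P$ is true and $0$ otherwise (and $A_k(a,0)=B_k(a,0)=0$ when $p\nmid k$). The number of monic irreducible factors of $g$ of degree $i$ counted with multiplicity is $\sum_{h\in I_i}\max\{k:h^k\mid g\}$. *)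

(* Defs.v *)
From mathcomp Require Import all_boot all_order all_algebra finmap.

Set Implicit Arguments.
Unset Strict Implicit.
Unset Printing Implicit Defensive.

Import GRing.Theory Num.Theory.

Local Open Scope ring_scope.

Section ArithmeticNumbers.

Definition squarefree (n : nat) : bool :=
  (0 < n)%N && all (fun r => ~~ (r ^ 2 %| n)%N) (primes n).

Definition moebius (n : nat) : rat :=
  if squarefree n then (-1) ^+ size (primes n) else 0.

Definition gbin (x : rat) (n : nat) : rat :=
  (\prod_(s < n) (x - s%:R)) / n`!%:R.

(* The values of a_num and b_num are integers for q a power of p and i > 0;
   they are kept in rat because of the divisions. *)
Definition a_num (p q i : nat) : rat :=
  (\sum_(k <- divisors i | ~~ (p %| k)%N) moebius k * q%:R ^+ (i %/ k))
    / (i%:R * q%:R).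

Definition b_num (p q i : nat) : rat :=
  (\sum_(k <- divisors i | (p %| k)%N) moebius k * q%:R ^+ (i %/ k)) / i%:R.

Definition A_num (p q k : nat) (a b : rat) : rat :=
  if b == 0 then
    gbin (a * q%:R / p%:R) (k %/ p) * (-1) ^+ (k + k %/ p) * (p %| k)%N%:R
  else
    \sum_(0 <= j < (k %/ p).+1)
      gbin (a * q%:R / p%:R) j * gbin b (k - p * j) * (-1) ^+ (j + p * j).

(* The arguments "... - 1" of gbin are rationals, so nothing is truncated. *)
Definition B_num (p q k : nat) (a b : rat) : rat :=
  if b == 0 then
    gbin (a * q%:R / p%:R + (k %/ p)%:R - 1) (k %/ p) * (p %| k)%N%:R
  else
    \sum_(0 <= j < (k %/ p).+1)
      gbin (a * q%:R / p%:R + j%:R - 1) j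
      * gbin (b + (k - p * j)%:R - 1) (k - p * j).

End ArithmeticNumbers.

Section Polynomials.

Variable F : finFieldType.

(* {poly_n F} is the finite type of polynomials of size at most n, and
   size g = n.+1 says that g has degree n. *)
Definition monic_irr (i : nat) : {set {poly_i.+1 F}} :=
  [set h : {poly_i.+1 F} |
    [&& size h == i.+1, (h : {poly F}) \is monic & irreducibleb (h : {poly F})]].

(* For g != 0 and h nonconstant, h ^+ k %| g forces k < size g, so the bound on
   k loses nothing. *)
Definition multiplicity (h g : {poly F}) : nat :=
  (\max_(k < size g | (h ^+ k %| g)%R) k)%N.

Definition nb_irr_factors (i : nat) (g : {poly F}) : nat :=
  (\sum_(h in monic_irr i) multiplicity (h : {poly F}) g)%N.

Definition Nstar (m : nat) (T : {fset nat}) (l : T -> nat) (alpha : F) : nat :=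
  #|[set g : {poly_m.+1 F} |
      [&& size g == m.+1, (g : {poly F}) \is monic, g`_m.-1 == alpha
        & [forall i : T, nb_irr_factors (val i) (g : {poly F}) == l i]]]|.

Definition v (q : nat) (alpha : F) : rat := q%:R * (alpha == 0)%:R - 1.

End Polynomials.

(* Main.v *)
Require Import Defs.
From mathcomp Require Import all_boot all_order all_algebra all_fingroup.
From mathcomp Require Import all_field all_character finmap ring zify.

(* For an additive character psi of F, the map
   chi(f) = psi(coefficient of X^(deg f - 1)) is multiplicative on monic
   polynomials. Removing Euler factors one irreducible at a time shows that the
   generating series of chi over the polynomials with l_i irreducible factors of
   degree i is
     prod_(i in T) (h_(l_i)(chi on I_i) X^(i l_i)
                    * prod_(h in I_i) (1 - chi(h) X^i))
   times the L-series of chi, where h_l is the complete symmetric function. The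
   L-series is 1/(1 - q X) for the trivial character and 1 for the others.
   Comparing power sums (Newton's identities) in the full Euler product and
   inverting by Moebius gives sum_(h in I_i) chi(h)^k = b_i + 1[p | k] q a_i for
   psi nontrivial, so that prod_(h in I_i) (1 - chi(h) X) is, by Newton again,
   (1 - X)^(b_i) (1 - X^p)^(a_i q / p), independently of psi. Averaging over
   psi against psi(-alpha) selects the prescribed coefficient. *)

Set Implicit Arguments.
Unset Strict Implicit.
Unset Printing Implicit Defensive.

Import Order.TTheory GRing.Theory Num.Theory.

Local Open Scope ring_scope.

(** * Polynomials modulo X^N and Newton's identities *)

Section TruncatedPolynomials.

Variables (K : numFieldType) (N : nat).
Implicit Types P Q S C : {poly K}.

(** Polynomials stand for power series truncated at order [N]; coefficients of index [N] and above
    are arbitrary. *)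
Definition eqX P Q := forall n, (n < N)%N -> P`_n = Q`_n.

Lemma eqX_refl P : eqX P P. Proof. by []. Qed.

Lemma eqX_sym P Q : eqX P Q -> eqX Q P.
Proof. by move=> PQ n ltnN; rewrite PQ. Qed.

Lemma eqX_trans Q P R : eqX P Q -> eqX Q R -> eqX P R.
Proof. by move=> PQ QR n ltnN; rewrite PQ ?QR. Qed.

Lemma eqXD P P' Q Q' : eqX P P' -> eqX Q Q' -> eqX (P + Q) (P' + Q').
Proof. by move=> PP QQ n ltnN; rewrite !coefD PP ?QQ. Qed.

Lemma eqXM P P' Q Q' : eqX P P' -> eqX Q Q' -> eqX (P * Q) (P' * Q').
Proof.
move=> PP QQ n ltnN; rewrite !coefM; apply: eq_bigr => i _.
by rewrite PP ?QQ // (leq_ltn_trans _ ltnN) // ?leq_subr // -ltnS.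
Qed.

Lemma eqX_prod (I : Type) (r : seq I) (P Q : I -> {poly K}) :
  (forall i, eqX (P i) (Q i)) -> eqX (\prod_(i <- r) P i) (\prod_(i <- r) Q i).
Proof. by move=> PQ; elim/big_ind2: _ => // *; apply: eqXM. Qed.

Lemma eqX_comp_Xn i P Q :
  (0 < i)%N -> eqX P Q -> eqX (P \Po 'X^i) (Q \Po 'X^i).
Proof.
move=> i0 PQ n ltnN; rewrite !coef_comp_poly_Xn //; case: ifP => // _.
by apply: PQ; apply: leq_ltn_trans ltnN; exact: leq_div.
Qed.

(* With C = \prod_x (1 - x X)^-1, the polynomial S has the power sums of the x
   as coefficients: this is Newton's identity X C' = S C. *)
Definition newton S C := C`_0 = 1 /\ eqX ('X * C^`()) (S * C).

Lemma newton1 : newton 0 1.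
Proof. by split; rewrite ?coefE // derivC mulr0 mul0r. Qed.

Lemma newtonM S C S' C' :
  newton S C -> newton S' C' -> newton (S + S') (C * C').
Proof.
move=> [C0 SC] [C0' SC']; split.
  by rewrite coefM big_ord1 C0 C0' mulr1.
have -> : 'X * (C * C')^`() = ('X * C^`()) * C' + ('X * C'^`()) * C.
  by rewrite derivM; ring.
apply: eqX_trans (eqXD (eqXM SC (eqX_refl C')) (eqXM SC' (eqX_refl C))) _.
by have -> : S * C * C' + S' * C' * C = (S + S') * (C * C') by ring.
Qed.

Lemma newton_prod (I : eqType) (r : seq I) (S C : I -> {poly K}) :
  {in r, forall i, newton (S i) (C i)} ->
  newton (\sum_(i <- r) S i) (\prod_(i <- r) C i).
Proof.
move=> SC; rewrite [X in newton X _]big_seq [X in newton _ X]big_seq.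
elim/big_ind2: _ => [|????|]; [exact: newton1|exact: newtonM|exact: SC].
Qed.

(** By the chain rule, X (C(X^i))' = i (X C')(X^i). *)
Lemma newton_comp_Xn i S C : (0 < i)%N ->
  newton S C -> newton (i%:R * (S \Po 'X^i)) (C \Po 'X^i).
Proof.
move=> i0 [C0 SC]; split; first by rewrite coef_comp_poly_Xn // dvdn0 div0n.
have -> : 'X * (C \Po 'X^i)^`() = i%:R * (('X * C^`()) \Po 'X^i).
  rewrite deriv_comp derivXn comp_polyM comp_polyX.
  have e : 'X^i = 'X * 'X^(i.-1) :> {poly K} by rewrite -exprS prednK.
  by rewrite -mulr_natl [X in _ = _ * (X * _)]e; ring.
rewrite -mulrA -comp_polyM; apply: eqXM => //.
exact: eqX_comp_Xn.
Qed.

Lemma newton_eqX S S' C : eqX S S' -> newton S C -> newton S' C.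
Proof.
by move=> SS [C0 SC]; split=> //; apply: eqX_trans SC _; apply: eqXM.
Qed.

(** Knowing C modulo X^N determines C' only modulo X^(N-1); the factor X in Newton's identity
    restores the lost order. *)
Lemma newton_eqXr S C C' : (0 < N)%N -> eqX C C' -> newton S C -> newton S C'.
Proof.
move=> N0 CC [C0 SC]; split=> //; first by rewrite -CC.
have XC : eqX ('X * C^`()) ('X * C'^`()).
  move=> [|n] ltnN; rewrite !coefXM //= !coef_deriv.
  by rewrite CC.
by apply: eqX_trans (eqX_sym XC) _; apply: eqX_trans SC _; apply: eqXM.
Qed.

(** The constant coefficient of C is 1, so the product S C determines the coefficients of S one
    after the other. *)
Lemma newton_inj S S' C : newton S C -> newton S' C -> eqX S S'.
Proof.
move=> [C0 SC] [_ SC'] n; elim/ltn_ind: n => n IHn ltnN.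
have /eqP := eqX_trans (eqX_sym SC) SC' ltnN.
rewrite !coefM !big_ord_recr /= subnn C0 !mulr1.
rewrite (eq_bigr (fun i : 'I_n => S'`_i * C`_(n - i))); last first.
  by move=> i _; rewrite IHn // (ltn_trans _ ltnN).
by rewrite (inj_eq (addrI _)) => /eqP.
Qed.

(** Since S has no constant term, Newton's identity expresses n C_n through earlier coefficients of
    C; characteristic zero allows division by n. *)
Lemma newton_uniq S C C' : S`_0 = 0 ->
  newton S C -> newton S C' -> eqX C C'.
Proof.
move=> S0 [C0 SC] [C0' SC'] n; elim/ltn_ind: n => -[|n] IHn ltnN.
  by rewrite C0 C0'.
have n0 : n.+1%:R != 0 :> K by rewrite pnatr_eq0.
have e (D : {poly K}) : eqX ('X * D^`()) (S * D) ->
    n.+1%:R * D`_n.+1 = \sum_(i < n.+1) S`_i.+1 * D`_(n - i).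
  move=> /(_ _ ltnN); rewrite coefXM /= coef_deriv coefM big_ord_recl S0 mul0r.
  by rewrite add0r mulr_natl => ->.
apply: (mulfI n0); rewrite !e //; apply: eq_bigr => i _.
by rewrite IHn // ?ltnS ?leq_subr // (leq_ltn_trans _ ltnN) // leqW ?leq_subr.
Qed.

Definition geometric (x : K) : {poly K} := \poly_(n < N) x ^+ n.
(** The truncation of x X / (1 - x X): power sums of the single variable x, with 0 at index 0
    because X C' has no constant term. *)
Definition powers (x : K) : {poly K} := \poly_(n < N) (x ^+ n *+ (0 < n)%N).

Lemma coef_geometric x n : (n < N)%N -> (geometric x)`_n = x ^+ n.
Proof. by move=> ltnN; rewrite coef_poly ltnN. Qed.

Lemma coef_powers x n : (n < N)%N -> (powers x)`_n = x ^+ n *+ (0 < n)%N.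
Proof. by move=> ltnN; rewrite coef_poly ltnN. Qed.

Lemma geometricP x : eqX ((1 - x *: 'X) * geometric x) 1.
Proof.
move=> n ltnN; rewrite mulrBl mul1r -scalerAl coefB coefZ coefXM coef1.
rewrite coef_geometric //; case: n ltnN => [|n] ltnN /=;
  first by rewrite mulr0 subr0.
by rewrite coef_geometric ?(ltn_trans _ ltnN) // -exprS subrr.
Qed.

Lemma newton_lin x : newton (- powers x) (1 - x *: 'X).
Proof.
split; first by rewrite !coefE mulr0 subr0.
move=> n ltnN; rewrite derivB derivZ derivX derivC sub0r mulrBr mulr1.
rewrite mulrN -!scalerAr mulr1 coefN coefZ coefX coefB coefN coefZ.
rewrite coefMX coef_powers // coefN.
case: n ltnN => [|[|n]] ltnN /=.
- by rewrite !mulr0 !subr0.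
- rewrite coef_powers ?(ltn_trans _ ltnN) //.
  by rewrite mulr0n oppr0 mulr0 subr0 mulr1 expr1.
- rewrite coef_powers ?(ltn_trans _ ltnN) //.
  by rewrite mulrN -exprS opprK mulr0 oppr0 addNr.
Qed.

(** Differentiating C D = 1 shows that the logarithmic derivative changes sign under inversion. *)
Lemma newton_opp S C D :
  (0 < N)%N -> eqX (C * D) 1 -> newton S C -> newton (- S) D.
Proof.
move=> N0 CD [C0 SC].
have D0 : D`_0 = 1 by have:= CD 0%N N0; rewrite coefM big_ord1 C0 mul1r coefE.
split=> //.
have CDC : eqX (D * (C * D)) D by rewrite -[X in eqX _ X]mulr1; apply: eqXM.
have XCD : eqX ('X * (C * D)^`()) 0.
  move=> [|n] ltnN; rewrite coefXM coef0 //= coef_deriv CD // coef1.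
  by rewrite mul0rn.
have e : 'X * D^`() * (C * D) = D * ('X * (C * D)^`()) - ('X * C^`()) * D * D.
  by rewrite derivM; ring.
apply: (@eqX_trans ('X * D^`() * (C * D))).
  by rewrite -[X in eqX X _]mulr1; apply: eqXM => //; exact: eqX_sym.
rewrite {}e; apply: (@eqX_trans (D * 0 - S * C * D * D)).
  apply: eqXD; first exact: eqXM.
  move=> n ltnN; rewrite !coefN; congr (- _).
  by move: n ltnN; do 2!apply: eqXM => //.
rewrite mulr0 sub0r -!mulrA -mulNr; apply: eqXM => //.
by rewrite mulrCA.
Qed.

Lemma newton_geometric x : (0 < N)%N -> newton (powers x) (geometric x).
Proof.
by move=> N0; rewrite -[powers x]opprK;
  apply: newton_opp (@geometricP x) (newton_lin x).
Qed.

End TruncatedPolynomials.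

(** * Generalized binomial coefficients and binomial series *)

Lemma sum_multiples (V : nmodType) (p n : nat) (f : nat -> V) : (0 < p)%N ->
  \sum_(0 <= i < n.+1 | (p %| i)%N) f i
  = \sum_(0 <= j < (n %/ p).+1) f (p * j)%N.
Proof.
move=> p0; elim: n => [|n IHn].
  by rewrite div0n big_mkcond !big_nat1 dvdn0 muln0.
rewrite big_mkcond big_nat_recr //= -big_mkcond IHn divnS //.
case: ifP => pn; last by rewrite addr0 add0n.
rewrite add1n [RHS]big_nat_recr //=; congr (_ + f _).
by apply/esym; rewrite mulnC -[RHS](divnK pn) divnS // pn.
Qed.

Lemma gbin0 x : gbin x 0 = 1.
Proof. by rewrite /gbin big_ord0 fact0 divr1. Qed.

(** Upper negation: the order of the n factors is reversed and all their signs are changed. *)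
Lemma gbin_negate x n : gbin x n * (-1) ^+ n = gbin (- x + n%:R - 1) n.
Proof.
rewrite /gbin mulrAC; congr (_ / _).
rewrite [RHS](reindex_inj rev_ord_inj) /= mulrC -{1}[n]card_ord -prodrN.
apply: eq_bigr => s _; rewrite natrB ?ltn_ord // -natr1; ring.
Qed.

(** The truncation of (1 - X)^(-x). *)
Definition gbin_series (N : nat) (x : rat) : {poly rat} :=
  \poly_(n < N) gbin (x + n%:R - 1) n.

(** For C = (1 - X)^(-x) one has X C' / C = x X / (1 - X). In coefficients this is the recursion
    [step], summed up in [sum]. *)
Lemma newton_gbin_series N x : (0 < N)%N ->
  newton N (x *: powers N 1) (gbin_series N x).
Proof.
move=> N0; have step n : n.+1%:R * gbin (x + n.+1%:R - 1) n.+1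
    = (x + n%:R) * gbin (x + n%:R - 1) n.
  rewrite /gbin big_ord_recl factS natrM.
  have f0 : n`!%:R != 0 :> rat by rewrite pnatr_eq0 -lt0n fact_gt0.
  have n0 : n.+1%:R != 0 :> rat by rewrite pnatr_eq0.
  rewrite (eq_bigr (fun i : 'I_n => x + n%:R - 1 - i%:R)); last first.
    by move=> i _; rewrite /= /bump /= add1n -!natr1; ring.
  by rewrite -natr1 /= subr0 in n0 *; field; rewrite n0 f0.
have sum n : n%:R * gbin (x + n%:R - 1) n
    = x * \sum_(i < n) gbin (x + i%:R - 1) i.
  elim: n => [|n IHn]; first by rewrite big_ord0 mul0r mulr0.
  by rewrite big_ord_recr mulrDr -IHn step; ring.
split=> [|n ltnN]; first by rewrite coef_poly N0 gbin0.
rewrite coefXM; case: n ltnN => [|n] ltnN /=.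
  by rewrite coefM big_ord1 coefZ coef_powers // mulr0n mulr0 mul0r.
rewrite coef_deriv coef_poly ltnN -[LHS]mulr_natl sum -scalerAl coefZ.
congr (_ * _).
rewrite coefMr [RHS]big_ord_recr /= subnn coef_powers // mulr0n mul0r addr0.
apply: eq_bigr => i _; have ltiN := ltn_trans (ltn_ord i) ltnN.
rewrite coef_powers ?(leq_ltn_trans (leq_subr _ _)) // subn_gt0 ltn_ord.
by rewrite expr1n mul1r coef_poly ltiN.
Qed.

Lemma coef_gbin_comp (N p n : nat) (x y : rat) : (0 < p)%N -> (n < N)%N ->
  (gbin_series N x * (gbin_series N y \Po 'X^p))`_n
  = \sum_(0 <= j < (n %/ p).+1)
      gbin (x + (n - p * j)%:R - 1) (n - p * j) * gbin (y + j%:R - 1) j.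
Proof.
move=> p0 ltnN; rewrite coefMr.
pose f i := gbin (x + (n - i)%:R - 1) (n - i)
  * gbin (y + (i %/ p)%:R - 1) (i %/ p).
transitivity (\sum_(0 <= i < n.+1 | (p %| i)%N) f i).
  rewrite [RHS]big_mkcond big_mkord; apply: eq_bigr => i _.
  have lein : (i <= n)%N by rewrite -ltnS.
  rewrite coef_comp_poly_Xn //; case: ifP => _; last by rewrite mulr0.
  rewrite !coef_poly !ifT // (leq_ltn_trans _ ltnN) ?leq_subr //.
  exact: leq_trans (leq_div _ _) lein.
rewrite sum_multiples //; apply: eq_bigr => j _.
by rewrite /f mulKn.
Qed.

Lemma gbin_pred n : gbin (0 + n%:R - 1) n = (n == 0)%:R.
Proof.
case: n => [|n]; first exact: gbin0.
by rewrite /gbin big_ord_recr /= -natr1 add0r addrK subrr mulr0 mul0r.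
Qed.

(** As (1 - X)^0 = 1, only a term with p j = n survives; this reconciles the clause b = 0 of [A_num]
    and [B_num] with the general one. *)
Lemma sum_gbin0 (p n : nat) (f : nat -> rat) : (0 < p)%N ->
  \sum_(0 <= j < (n %/ p).+1)
      gbin (0 + (n - p * j)%:R - 1) (n - p * j) * f j
  = f (n %/ p)%N * (p %| n)%:R.
Proof.
move=> p0; rewrite big_nat_recr //= gbin_pred big_nat big1 ?add0r.
  rewrite mulrC; congr (_ * _%:R).
  by rewrite subn_eq0 dvdn_eq eqn_leq leq_divM mulnC.
move=> j /andP[_ ltj]; rewrite gbin_pred subn_eq0 [(_ <= _)%N]negbTE ?mul0r //.
rewrite -ltnNge (leq_trans _ (leq_divM n p)) // mulnC ltn_pmul2r //.
Qed.

Section AB.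

Variables (N p q : nat) (p_gt0 : (0 < p)%N).

(** Modulo X^N this is (1 - X)^(-b) (1 - X^p)^(-a q / p). *)
Definition AB_series (a b : rat) : {poly rat} :=
  gbin_series N b * (gbin_series N (a * q%:R / p%:R) \Po 'X^p).

Lemma coef_B (a b : rat) n : (n < N)%N -> B_num p q n a b = (AB_series a b)`_n.
Proof.
move=> ltnN; rewrite coef_gbin_comp // /B_num; case: eqP => [->|_].
  by rewrite (sum_gbin0 _ (fun j => gbin (a * q%:R / p%:R + j%:R - 1) j)).
by apply: eq_bigr => j _; rewrite mulrC.
Qed.

(** Upper negation in both binomial factors produces the sign (-1)^(j + n - p j), which agrees with
    the sign (-1)^(j + p j + n) on the left. *)
Lemma coef_A (a b : rat) n : (n < N)%N ->
  A_num p q n a b * (-1) ^+ n = (AB_series (- a) (- b))`_n.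
Proof.
move=> ltnN; rewrite coef_gbin_comp // /A_num !mulNr.
case: eqP => [->|_].
  pose f j := gbin (- (a * q%:R / p%:R) + j%:R - 1) j.
  rewrite oppr0 (sum_gbin0 _ f) // /f -gbin_negate.
  have sgn1 : (-1) ^+ n * (-1) ^+ n = 1 :> rat by rewrite -expr2 sqrr_sign.
  by rewrite exprD -[RHS]mulr1 -[X in _ = _ * X]sgn1; ring.
rewrite mulr_suml; apply: eq_big_nat => j; rewrite ltnS leq_divRL // => lejn.
rewrite mulnC in lejn; rewrite -!gbin_negate exprD.
rewrite -[X in _ * (-1) ^+ X = _](subnK lejn) exprD.
have sgn1 : (-1) ^+ (p * j) * (-1) ^+ (p * j) = 1 :> rat.
  by rewrite -expr2 sqrr_sign.
by rewrite -[RHS]mulr1 -[X in _ = _ * X]sgn1; ring.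
Qed.

(** The factor in X contributes b at every positive index; the one in X^p contributes p (a q / p) =
    a q at the multiples of p. *)
Lemma newton_AB (a b : rat) : (0 < N)%N ->
  newton N (\poly_(n < N) ((b + a * q%:R *+ (p %| n)%N) *+ (0 < n)%N))
    (AB_series a b).
Proof.
move=> N0; have N1 c := newton_gbin_series c N0.
apply: newton_eqX (newtonM (N1 b) (newton_comp_Xn p_gt0 (N1 _))) => n ltnN.
rewrite coefD coefZ coef_powers // expr1n mulr_natl coefMn.
rewrite coef_comp_poly_Xn // coef_poly ltnN.
have [->|n0] := posnP n;
  first by rewrite dvdn0 div0n coefZ coef_powers // !mulr0 mul0rn addr0.
case: ifP => [pn|_]; last by rewrite mul0rn !mulr1n mulr1.
have np0 : (0 < n %/ p)%N by rewrite divn_gt0 // dvdn_leq.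
rewrite coefZ coef_powers ?(leq_ltn_trans (leq_div _ _)) // np0 expr1n !mulr1.
rewrite -[_ / _ *+ p]mulr_natr divfK // pnatr_eq0; lia.
Qed.

End AB.

(** * Monic and irreducible polynomials over a finite field *)

Section MonicPolynomials.

Variable F : finFieldType.
Implicit Types f g h : {poly F}.

(** Sequences of plain polynomials, since multiplication by a fixed h relates different degrees and
    hence different bounded types. *)
Definition monics n : seq {poly F} :=
  [seq polyn g | g : {poly_n.+1 F} in
     [pred g : {poly_n.+1 F} | (size g == n.+1) && (polyn g \is monic)]].

Lemma mem_monics n f : (f \in monics n) = (size f == n.+1) && (f \is monic).
Proof.
apply/imageP/andP => [[g /andP[sg mg] ->] //|[/eqP sf mf]].
have sfn : f \is a poly_of_size n.+1 by rewrite qualifE /= sf.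
by exists (NPoly sfn) => //; rewrite inE /= sf eqxx.
Qed.

Lemma monics_uniq n : uniq (monics n).
Proof. by rewrite map_inj_uniq ?enum_uniq //; exact: val_inj. Qed.

Definition irreds i : seq {poly F} := [seq polyn x | x in monic_irr F i].

Definition is_irr h := (h \is monic) && irreducibleb h.

Lemma mem_irreds i h : (h \in irreds i) = (size h == i.+1) && is_irr h.
Proof.
apply/imageP/andP => [[g + ->]|[/eqP sh hP]].
  by rewrite inE => /andP[-> ?]; split.
have shn : h \is a poly_of_size i.+1 by rewrite qualifE /= sh.
by exists (NPoly shn) => //; rewrite inE /= sh eqxx.
Qed.

Lemma irreds_uniq i : uniq (irreds i).
Proof. by rewrite map_inj_uniq ?enum_uniq //; exact: val_inj. Qed.

Lemma size_irreds i : size (irreds i) = #|monic_irr F i|.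
Proof. by rewrite size_image. Qed.

Lemma is_irr_neq0 h : is_irr h -> h != 0.
Proof. by move=> /andP[/monic_neq0]. Qed.

Lemma is_irr_size h : is_irr h -> (1 < size h)%N.
Proof. by move=> /andP[_ /irreducibleP[]]. Qed.

Lemma is_irr_coprime h h' : is_irr h -> is_irr h' -> h != h' -> coprimep h h'.
Proof.
move=> /andP[mh /irreducibleP[_ Ph]] /andP[mh' /irreducibleP[_ Ph']].
apply: contraNT; rewrite coprimep_def => s1.
have := Ph _ s1 (dvdp_gcdl h h'); have := Ph' _ s1 (dvdp_gcdr h h').
rewrite eqp_sym => e1 e2; rewrite -eqp_monic //.
by rewrite eqp_sym (eqp_trans e1).
Qed.

Lemma dvdp_irr_mul h h' f : is_irr h -> is_irr h' -> h != h' ->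
  (h %| h' * f) = (h %| f).
Proof. by move=> Ph Ph' ne; rewrite Gauss_dvdpr // is_irr_coprime. Qed.

(** The maximum is attained, as k = 0 always qualifies, and lower powers of h divide higher ones. *)
Lemma dvdp_exp_multiplicity h f k : (1 < size h)%N -> f != 0 ->
  (h ^+ k %| f) = (k <= multiplicity h f)%N.
Proof.
move=> sh f0; have h0 : h != 0 by rewrite -size_poly_gt0 ltnW.
have f_gt0 : (0 < size f)%N by rewrite size_poly_gt0.
apply/idP/idP => [hkf|].
  have ltk : (k < size f)%N.
    apply: leq_trans (dvdp_leq f0 hkf).
    rewrite -(prednK (n := size _)) ?size_poly_gt0 ?expf_neq0 // size_exp ltnS.
    by rewrite leq_pmull // -subn1 subn_gt0.
  exact: (@leq_bigmax_cond _ _ (fun i : 'I_(size f) => i : nat) (Ordinal ltk)).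
have [|i hi e] := @eq_bigmax_cond _ (fun i : 'I_(size f) => h ^+ i %| f)
  (fun i => i : nat).
  by apply/card_gt0P; exists (Ordinal f_gt0); rewrite unfold_in expr0 dvd1p.
by rewrite [multiplicity h f]e => leki; apply: dvdp_trans hi; apply: dvdp_exp2l.
Qed.

(** Multiplicities are compared through the exponents k they dominate: for h = h' one factor h
    cancels, otherwise h' is prime to every power of h. *)
Lemma multiplicity_mul h h' f : is_irr h -> is_irr h' -> f != 0 ->
  multiplicity h (h' * f) = (multiplicity h f + (h == h'))%N.
Proof.
move=> Ph Ph' f0; have sh := is_irr_size Ph.
have hf0 : h' * f != 0 by rewrite mulf_neq0 // is_irr_neq0.
suff e k : (k <= multiplicity h (h' * f))%N
         = (k <= multiplicity h f + (h == h'))%N.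
  by apply/eqP; rewrite eqn_leq -e leqnn e leqnn.
rewrite -dvdp_exp_multiplicity //; have [<-|ne] := eqVneq h h'.
  case: k => [|k]; first by rewrite expr0 dvd1p.
  by rewrite exprS dvdp_mul2l ?is_irr_neq0 // addn1 ltnS dvdp_exp_multiplicity.
by rewrite Gauss_dvdpr ?addn0 -?dvdp_exp_multiplicity // coprimep_expl //
  is_irr_coprime.
Qed.

Lemma multiplicity_eq0 h f : is_irr h -> f != 0 ->
  (multiplicity h f == 0) = ~~ (h %| f).
Proof.
by move=> Ph f0; rewrite eqn0Ngt -dvdp_exp_multiplicity ?expr1 ?is_irr_size.
Qed.

Definition mult_sum (s : seq {poly F}) f := (\sum_(h <- s) multiplicity h f)%N.

Lemma nb_irr_factorsE i f : nb_irr_factors i f = mult_sum (irreds i) f.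
Proof. by rewrite /mult_sum big_image. Qed.

Lemma mult_sum_mul s h f : uniq s -> {in s, forall h, is_irr h} ->
  is_irr h -> f != 0 -> mult_sum s (h * f) = (mult_sum s f + (h \in s))%N.
Proof.
move=> us Ps Ph f0; rewrite /mult_sum -(count_uniq_mem h us) -sum1_count.
rewrite [X in (_ + X)%N]big_mkcond -big_split big_seq [RHS]big_seq /=.
apply: eq_bigr => h' /Ps Ph'; rewrite multiplicity_mul //.
Qed.

Lemma monics_mull h f d n : h \is monic -> size h = d.+1 -> (d <= n)%N ->
  (h * f \in monics n) = (f \in monics (n - d)).
Proof.
move=> mh sh ledn; rewrite !mem_monics monicMl //.
have [->|f0] := eqVneq f 0; first by rewrite mulr0 size_poly0.
by rewrite size_monicM // sh addSn /= -[n in _ == n.+1](subnKC ledn) -addnS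
  eqn_add2l.
Qed.

(** Multiplication by h is a bijection from the monic polynomials of degree n - d onto the monic
    multiples of h of degree n. *)
Lemma sum_monics_dvd (V : nmodType) h d n (w : {poly F} -> V) :
  h \is monic -> size h = d.+1 ->
  \sum_(f <- monics n | h %| f) w f
  = if (d <= n)%N then \sum_(f <- monics (n - d)) w (h * f) else 0.
Proof.
move=> mh sh; have h0 := monic_neq0 mh; case: leqP => [ledn|ltnd].
  rewrite -big_filter -(big_map (fun f => h * f) xpredT w); apply: perm_big.
  apply: uniq_perm => [||f].
  - by rewrite filter_uniq ?monics_uniq.
  - by rewrite map_inj_uniq ?monics_uniq //; exact: mulfI.
  rewrite mem_filter; apply/andP/mapP => [[/dvdpP[g ->]]|[g gn ->]].
    by rewrite mulrC (monics_mull _ mh sh ledn) => gn; exists g.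
  by rewrite dvdp_mulr // (monics_mull _ mh sh ledn).
rewrite big_seq_cond big1 // => f /andP[].
rewrite mem_monics => /andP[/eqP sf mf] /(dvdp_leq (monic_neq0 mf)).
by rewrite sh sf ltnS leqNgt ltnd.
Qed.

End MonicPolynomials.

(** * Generating series of weighted monic polynomials *)

Section WeightedSeries.

Variables (F : finFieldType) (K : numFieldType) (N : nat).
Variable chi : {poly F} -> K.
Implicit Types (f h : {poly F}) (w : {poly F} -> K) (s : seq {poly F}).

Definition series w : {poly K} := \poly_(n < N) \sum_(f <- monics F n) w f.

(** Only factors from [s] are extracted, so that [w] may be chi restricted by an indicator which
    these factors do not affect. *)
Definition twisted s w :=
  forall h f, h \in s -> f \is monic -> w (h * f) = chi h * w f.

Lemma eq_series w w' : (forall f, f \is monic -> w f = w' f) ->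
  series w = series w'.
Proof.
move=> e; apply/polyP => n; rewrite !coef_poly; case: ifP => // _.
by rewrite big_seq [RHS]big_seq; apply: eq_bigr => f;
  rewrite mem_monics => /andP[_ /e].
Qed.

Lemma seriesD w w' : series (fun f => w f + w' f) = series w + series w'.
Proof.
apply/polyP => n; rewrite coefD !coef_poly; case: ifP; last by rewrite addr0.
by rewrite big_split.
Qed.

Lemma seriesZ c w : series (fun f => c * w f) = c *: series w.
Proof.
apply/polyP => n; rewrite coefZ !coef_poly; case: ifP; last by rewrite mulr0.
by rewrite big_distrr.
Qed.

Lemma series_dvd h d w : h \is monic -> size h = d.+1 ->
  eqX N (series (fun f => (h %| f)%R%:R * w f))
        ('X^d * series (fun f => w (h * f))).
Proof.
move=> mh sh n ltnN; rewrite coef_poly ltnN coefXnM coef_poly.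
rewrite (leq_ltn_trans (leq_subr d n) ltnN).
transitivity (\sum_(f <- monics F n | h %| f) w f).
  by rewrite [RHS]big_mkcond; apply: eq_bigr => f _; case: ifP => _;
    rewrite ?mul1r ?mul0r.
by rewrite (sum_monics_dvd _ _ mh sh) ltnNge; case: leqP.
Qed.

(** The multiples of h contribute chi(h) X^d times the whole series, so discarding them removes the
    Euler factor of h. *)
Lemma series_ndvd h d w : is_irr h -> size h = d.+1 -> twisted [:: h] w ->
  eqX N (series (fun f => (~~ (h %| f)%R)%:R * w f))
        ((1 - chi h *: 'X^d) * series w).
Proof.
move=> Ph sh hw; have [mh _] := andP Ph.
have e : series w = series (fun f => (~~ (h %| f)%R)%:R * w f)
                    + series (fun f => (h %| f)%R%:R * w f).
  by rewrite -seriesD; apply: eq_series => f _; case: (h %| f);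
    rewrite ?mul1r ?mul0r ?addr0 ?add0r.
have -> : series (fun f => (~~ (h %| f)%R)%:R * w f)
          = series w - series (fun f => (h %| f)%R%:R * w f).
  by rewrite e addrK.
rewrite mulrBl mul1r => n ltnN; rewrite !coefB (series_dvd _ mh sh ltnN).
rewrite -scalerAl scalerAr -seriesZ; congr (_ - ('X^d * _)`__).
by apply: eq_series => f mf; rewrite hw ?mem_head.
Qed.

(** Below index [N], the coefficients are the complete symmetric functions of the values [chi h]. *)
Definition complete s : {poly K} := \prod_(h <- s) geometric N (chi h).

Lemma complete0 s : (0 < N)%N -> (complete s)`_0 = 1.
Proof.
move=> N0; rewrite /complete; elim/big_ind: _ => [|P Q P0 Q0|h _].
- by rewrite coef1.
- by rewrite coefM big_ord1 P0 Q0 mulr1.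
- by rewrite coef_geometric ?expr0.
Qed.

(** Multiplication by 1 - chi(h) X removes the factor of h. This is the recursion h_l(x, y) = h_l(y)
    + x h_(l-1)(x, y), with y for the other variables. *)
Lemma complete_cons h s l : (l < N)%N ->
  (complete (h :: s))`_l
  = (complete s)`_l
    + (if l is l'.+1 then chi h * (complete (h :: s))`_l' else 0).
Proof.
move=> ltlN; apply/eqP; rewrite -subr_eq; apply/eqP.
have /(_ l ltlN) := eqXM (@geometricP _ N (chi h)) (eqX_refl (complete s)).
have e : complete (h :: s) = geometric N (chi h) * complete s.
  by rewrite /complete big_cons.
rewrite mul1r -mulrA -e mulrBl mul1r coefB => <-.
congr (_ - _); rewrite -scalerAl coefZ coefXM.
by case: l {ltlN} => [|l]; rewrite ?mulr0.
Qed.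

(* Double induction: either h does not divide f, which costs the Euler factor of
   h, or f = h f' and f' has one factor less. *)
Lemma series_mult_sum s d l w : uniq s ->
  {in s, forall h, size h = d.+1 /\ is_irr h} -> twisted s w -> (l < N)%N ->
  eqX N (series (fun f => (mult_sum s f == l)%:R * w f))
        ((complete s)`_l *: 'X^(d * l) * \prod_(h <- s) (1 - chi h *: 'X^d)
         * series w).
Proof.
elim: s l w => [|h s IHs] l w.
  move=> _ _ _ ltlN; rewrite big_nil mulr1 /complete big_nil coef1.
  have -> : (l == 0)%:R *: 'X^(d * l) = ((l == 0)%:R)%:P :> {poly K}.
    by case: l {ltlN} => [|l]; rewrite ?scale0r // muln0 scale1r.
  rewrite mul_polyC -seriesZ (@eq_series _ (fun f => (l == 0)%:R * w f)) //.
  by move=> f _; rewrite /mult_sum big_nil eq_sym.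
move=> /[dup] uhs /= /andP[hs us] Phs hsw ltlN.
have [sh Ph] := Phs h (mem_head h s).
have Ps : {in s, forall h, size h = d.+1 /\ is_irr h}.
  by move=> g gs; apply: Phs; rewrite inE gs orbT.
have hw : twisted [:: h] w.
  by move=> g f; rewrite inE => /eqP ->; apply: hsw; exact: mem_head.
have sw : twisted s w by move=> g f gs; apply: hsw; rewrite inE gs orbT.
have s'w : twisted s (fun f => (~~ (h %| f)%R)%:R * w f).
  move=> g f gs mf; rewrite (sw g f gs mf) mulrCA.
  have ne : h != g by apply: contraNneq hs => ->.
  by have [_ Pg] := Ps g gs; rewrite (dvdp_irr_mul f Ph Pg ne).
have [mh _] := andP Ph.
elim: l ltlN => [|l IHl] ltlN; rewrite complete_cons // ?addr0.
  have e f : f \is monic -> (mult_sum (h :: s) f == 0)%:R * w f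
     = (mult_sum s f == 0)%:R * ((~~ (h %| f)%R)%:R * w f).
    move=> mf; rewrite /mult_sum big_cons addn_eq0 multiplicity_eq0 //.
      by rewrite mulrA -natrM mulnb andbC.
    exact: monic_neq0.
  rewrite (eq_series e).
  apply: eqX_trans (IHs _ _ us Ps s'w ltlN) _.
  apply: eqX_trans (eqXM (eqX_refl _) (series_ndvd Ph sh hw)) _.
  by rewrite big_cons; set P := (_ *: _); set Q := \prod_(_ <- _) _;
    rewrite mulrA -[P * Q * _]mulrA [Q * _]mulrC mulrA.
have e f : f \is monic -> (mult_sum (h :: s) f == l.+1)%:R * w f
     = (mult_sum s f == l.+1)%:R * ((~~ (h %| f)%R)%:R * w f)
       + (h %| f)%R%:R * ((mult_sum (h :: s) f == l.+1)%:R * w f).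
  move=> mf; have f0 := monic_neq0 mf.
  have := multiplicity_eq0 Ph f0; case: (h %| f) => /= m0.
    by rewrite mul0r mulr0 add0r mul1r.
  by rewrite /mult_sum big_cons (eqP m0) mul1r mul0r addr0.
rewrite (eq_series e) seriesD.
have Phs' : {in h :: s, forall h, is_irr h} by move=> g /Phs[].
apply: eqX_trans (eqXD (eqX_trans (IHs _ _ us Ps s'w ltlN)
  (eqXM (eqX_refl _) (series_ndvd Ph sh hw))) (series_dvd _ mh sh)) _.
rewrite (@eq_series
   (fun f => (mult_sum (h :: s) (h * f) == l.+1)%:R * w (h * f))
   (fun f => chi h * ((mult_sum (h :: s) f == l)%:R * w f))); last first.
  move=> f mf; rewrite hw ?mem_head // mult_sum_mul ?monic_neq0 //.
  by rewrite mem_head addn1 eqSS mulrCA.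
rewrite seriesZ -scalerAr scalerAl.
apply: eqX_trans (eqXD (eqX_refl _) (eqXM (eqX_refl _) (IHl (ltnW ltlN)))) _.
rewrite big_cons; set P := \prod_(_ <- _) _; set A := series _.
set L := 1 - _; rewrite !mulnS exprD -!mul_polyC !polyCD !polyCM.
set X := 'X^(d * l).
set c := ((complete s)`_l.+1)%:P; set c' := ((complete (h :: s))`_l)%:P.
have -> : (c + (chi h)%:P * c') * ('X^d * X) * (L * P) * A
  = c * ('X^d * X) * P * (L * A) + (chi h)%:P * 'X^d * (c' * X * (L * P) * A).
  by ring.
exact: eqX_refl.
Qed.

(** One degree is treated at a time: as [d] is injective, multiplying by an irreducible of degree
    [d i] leaves the counts in the other degrees unchanged, so the remaining weight is still
    twisted. *)
Lemma series_prod_mult_sum (I : eqType) (r : seq I) (s : I -> seq {poly F})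
    (d l : I -> nat) w :
  (forall i, uniq (s i)) ->
  (forall i, {in s i, forall h, size h = (d i).+1 /\ is_irr h}) ->
  injective d -> uniq r -> (forall i, twisted (s i) w) ->
  (forall i, l i < N)%N ->
  eqX N (series (fun f => (all (fun i => mult_sum (s i) f == l i) r)%:R * w f))
        (\prod_(i <- r) ((complete (s i))`_(l i) *: 'X^(d i * l i)
           * \prod_(h <- s i) (1 - chi h *: 'X^(d i))) * series w).
Proof.
move=> us Ps dI ur sw lN; elim: r ur => [|i r IHr] /=.
  move=> _; rewrite big_nil mul1r (@eq_series _ w) // => f _.
  by rewrite mul1r.
move=> /andP[ir /IHr {}IHr]; rewrite big_cons.
rewrite (@eq_series _ (fun f => (mult_sum (s i) f == l i)%:R *
  ((all (fun i => mult_sum (s i) f == l i) r)%:R * w f))); last first.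
  by move=> f _; rewrite mulrA -natrM mulnb.
rewrite -[X in eqX _ _ X]mulrA.
apply: eqX_trans (eqXM (eqX_refl _) IHr).
apply: series_mult_sum => // h f hi mf.
rewrite (sw i) // mulrCA; congr (_ * ((nat_of_bool _)%:R * _)).
apply: eq_in_all => j jr.
have [sh Ph] := Ps _ _ hi.
rewrite mult_sum_mul ?monic_neq0 //; last by move=> g /Ps[].
case: (boolP (h \in s j)) => [/Ps[]|]; last by rewrite addn0.
by rewrite sh => -[/dI e]; rewrite e jr in ir.
Qed.

End WeightedSeries.

(** * Moebius sums *)

Lemma squarefreeP n : (0 < n)%N ->
  reflect (forall r, prime r -> ~~ (r ^ 2 %| n)%N) (squarefree n).
Proof.
move=> n0; rewrite /squarefree n0; apply: (iffP allP) => [sqf r pr|sqf r].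
  apply/negP => r2n; have := sqf r; rewrite mem_primes pr n0 r2n.
  by rewrite (dvdn_trans _ r2n) ?dvdn_exp // => /(_ isT).
by rewrite mem_primes => /andP[/sqf].
Qed.

Lemma moebius_mul_prime r n : prime r -> (0 < n)%N ->
  moebius (r * n) = if (r %| n)%N then 0 else - moebius n.
Proof.
move=> pr n0; have r0 := prime_gt0 pr; rewrite /moebius.
have rn0 : (0 < r * n)%N by rewrite muln_gt0 r0.
have [rn|nrn] := boolP (r %| n)%N.
  case: (squarefreeP rn0) => // /(_ r pr).
  by rewrite -mulnn dvdn_pmul2l // rn.
have -> : squarefree (r * n) = squarefree n.
  apply/(squarefreeP rn0)/(squarefreeP n0) => sqf s ps.
    by apply: contra (sqf s ps) => /dvdn_mull ->.
  have [->|nesr] := eqVneq s r.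
    by rewrite -mulnn dvdn_pmul2l.
  rewrite Gauss_dvdr ?sqf // coprimeXl //.
  by rewrite prime_coprime // dvdn_prime2.
case: ifP => _; last by rewrite oppr0.
rewrite (perm_size (_ : perm_eq _ (r :: primes n))) ?exprS ?mulN1r //=.
apply: uniq_perm => [||s]; rewrite /= ?primes_uniq //.
  by rewrite mem_primes (negbTE nrn) !andbF.
by rewrite primesM // primes_prime // inE.
Qed.

Lemma moebius1 : moebius 1 = 1.
Proof. by []. Qed.

(* With r a prime factor of n, the divisors d and r d of n cancel when r does
   not divide d. *)
Lemma sum_moebius n : (0 < n)%N ->
  \sum_(d <- divisors n) moebius d = (n == 1)%:R.
Proof.
move=> n0; have [n1|n1|->] := ltngtP n 1; last by rewrite big_seq1.
  by rewrite ltnNge n0 in n1.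
have [pr rn] := (pdiv_prime n1, pdiv_dvd n); set r := pdiv n in pr rn.
have r0 := prime_gt0 pr.
have [n' def_n] := dvdnP rn; rewrite mulnC in def_n.
have n'0 : (0 < n')%N by move: n0; rewrite def_n muln_gt0 => /andP[].
rewrite (bigID (dvdn r)) /= addrC.
rewrite -big_filter -[X in _ + X]big_filter.
rewrite (perm_big [seq d <- divisors n' | ~~ (r %| d)%N]); last first.
  apply: uniq_perm; rewrite ?filter_uniq ?divisors_uniq // => d.
  rewrite !mem_filter -!dvdn_divisors //; case: (boolP (r %| d)%N) => //= rd.
  by rewrite def_n Gauss_dvdr // coprime_sym prime_coprime.
rewrite [X in _ + X](perm_big [seq (r * d)%N | d <- divisors n']); last first.
  apply: uniq_perm => [||d]; first by rewrite filter_uniq ?divisors_uniq.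
    rewrite map_inj_uniq ?divisors_uniq // => x y /eqP.
    by rewrite eqn_pmul2l // => /eqP.
  rewrite mem_filter -dvdn_divisors //; apply/andP/mapP => [[/dvdnP[k ->]]|[k]].
    rewrite mulnC def_n dvdn_pmul2l // => kn'; exists k => //.
    by rewrite -dvdn_divisors.
  by rewrite -dvdn_divisors // => kn' ->;
    rewrite dvdn_mulr // def_n dvdn_pmul2l.
rewrite big_map big_filter [X in X + _]big_mkcond -big_split big_seq big1 //=.
move=> d; rewrite -dvdn_divisors // => /(dvdn_gt0 n'0) d0.
by rewrite moebius_mul_prime //; case: (r %| d)%N; rewrite /= ?addr0 ?addrN.
Qed.

(** The pairs k | i | n correspond to the pairs j | n, k | n / j through j = i / k. *)
Lemma sum_divisors_flip (V : nmodType) n (G : nat -> nat -> V) : (0 < n)%N ->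
  \sum_(i <- divisors n) \sum_(k <- divisors i) G (i %/ k)%N k
  = \sum_(j <- divisors n) \sum_(k <- divisors (n %/ j)) G j k.
Proof.
move=> n0.
pose H (x : nat * nat) := G x.1 x.2.
rewrite -(@big_allpairs_dep _ _ _ _ _ _ (fun i k => (i %/ k, k)%N) _ divisors
  H).
rewrite -(@big_allpairs_dep _ _ _ _ _ _ pair _ (fun j => divisors (n %/ j)) H).
apply: perm_big; apply: uniq_perm => [||[j k]].
- apply: allpairs_uniq_dep => [|i _|]; rewrite ?divisors_uniq //.
  move=> _ _ /allpairsPdep[i [k [+ + ->]]] /allpairsPdep[i' [k' [+ + ->]]].
  move=> di dk di' dk' [+ ek]; rewrite -{}ek {k'} in dk' *.
  rewrite -dvdn_divisors // in di; rewrite -dvdn_divisors // in di'.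
  rewrite -dvdn_divisors ?(dvdn_gt0 n0 di) // in dk.
  rewrite -dvdn_divisors ?(dvdn_gt0 n0 di') // in dk'.
  by move=> /(congr1 (muln^~ k)); rewrite !divnK // => ->.
- apply: allpairs_uniq_dep => [|j _|]; rewrite ?divisors_uniq //.
  by move=> [j k] [j' k'] _ _ [-> ->].
apply/allpairsPdep/allpairsPdep =>
  [[i [k' [+ + [-> ->]]]]|[j' [k' [+ + [-> ->]]]]].
  rewrite -dvdn_divisors // => din; have i0 := dvdn_gt0 n0 din.
  rewrite -dvdn_divisors // => dk; have k0 := dvdn_gt0 i0 dk.
  have jn : (i %/ k' %| n)%N by apply: dvdn_trans din; exact: dvdn_div.
  exists (i %/ k')%N, k'; split=> //; rewrite -dvdn_divisors //.
    by rewrite dvdn_divRL // mulnC divnK.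
  by rewrite divn_gt0 ?(dvdn_gt0 n0 jn) // dvdn_leq.
rewrite -dvdn_divisors // => djn; have j0 := dvdn_gt0 n0 djn.
have nj0 : (0 < n %/ j')%N by rewrite divn_gt0 // dvdn_leq.
rewrite -dvdn_divisors // => dk; have k0 := dvdn_gt0 nj0 dk.
exists (j' * k')%N, k'; split; last by rewrite mulnK.
  by rewrite -dvdn_divisors // mulnC -dvdn_divRL.
by rewrite -dvdn_divisors ?muln_gt0 ?j0 // dvdn_mull.
Qed.

Section NecklaceNumbers.

Variables (p q : nat).
Hypothesis p_prime : prime p.

(** When q is the order of the field, this is n times the number of monic irreducible polynomials of
    degree n. *)
Definition necklace n : rat :=
  \sum_(k <- divisors n) moebius k * q%:R ^+ (n %/ k).

(** This is n b_n; subtracted from [necklace n] it leaves n q a_n. *)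
Definition necklace_p n : rat :=
  \sum_(k <- divisors n | (p %| k)%N) moebius k * q%:R ^+ (n %/ k).

(** Moebius inversion: once the sums are exchanged, the inner Moebius sum vanishes except for j =
    n. *)
Lemma sum_necklace n : (0 < n)%N ->
  \sum_(i <- divisors n) necklace i = q%:R ^+ n.
Proof.
move=> n0; rewrite (sum_divisors_flip (fun j k => moebius k * q%:R ^+ j)) //.
under eq_bigr do rewrite -mulr_suml.
rewrite (bigD1_seq n) ?divisors_uniq -?dvdn_divisors //= divnn n0.
rewrite big_seq1 moebius1 mul1r big_seq_cond big1 ?addr0 // => j.
rewrite -dvdn_divisors // => /andP[jn nej].
have j0 := dvdn_gt0 n0 jn.
have nj0 : (0 < n %/ j)%N by rewrite divn_gt0 // dvdn_leq.
rewrite (sum_moebius nj0); case: eqP => [e|_]; last by rewrite mul0r.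
by rewrite -(divnK jn) e mul1n eqxx in nej.
Qed.

(* With i = j k, the prime p divides k or n / i if and only if it divides
   n / j; the terms regroup into Moebius sums over the divisors of n / j. *)
Lemma sum_necklace_p n : (0 < n)%N ->
  \sum_(i <- divisors n)
     (if (p %| n %/ i)%N then necklace i else necklace_p i) = 0.
Proof.
move=> n0.
pose G j k : rat := if (p %| n %/ j)%N then moebius k * q%:R ^+ j else 0.
transitivity (\sum_(i <- divisors n) \sum_(k <- divisors i) G (i %/ k)%N k).
  rewrite big_seq [RHS]big_seq; apply: eq_bigr => i.
  rewrite -dvdn_divisors // => din; have i0 := dvdn_gt0 n0 din.
  have e k : (k %| i)%N ->
      (p %| n %/ (i %/ k))%N = (p %| n %/ i)%N || (p %| k)%N.
    move=> ki; have k0 := dvdn_gt0 i0 ki.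
    rewrite -Euclid_dvdM //; congr (_ %| _)%N.
    rewrite -[X in (X %/ (_ %/ _))%N](divnK din).
    rewrite -[X in (_ * X %/ _)%N](divnK ki).
    by rewrite [(i %/ k * k)%N]mulnC mulnA mulnK // divn_gt0 // dvdn_leq.
  rewrite /G /necklace_p /necklace; case: ifP => pni.
    rewrite big_seq [RHS]big_seq; apply: eq_bigr => k.
    by rewrite -dvdn_divisors // => ki; rewrite e // pni.
  rewrite big_mkcond big_seq [RHS]big_seq; apply: eq_bigr => k.
  by rewrite -dvdn_divisors // => ki; rewrite e // pni.
rewrite sum_divisors_flip // big_seq big1 // => j.
rewrite -dvdn_divisors // => djn; have j0 := dvdn_gt0 n0 djn.
rewrite {}/G; case: (boolP (p %| n %/ j)%N) => pnj; last by rewrite big1.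
have nj0 : (0 < n %/ j)%N by rewrite divn_gt0 // dvdn_leq.
rewrite -big_distrl /= (sum_moebius nj0).
case: eqP pnj => [->|_ _]; last by rewrite mul0r.
by rewrite dvdn1 => /eqP p1; have := prime_gt1 p_prime; rewrite p1.
Qed.

End NecklaceNumbers.

(** * Additive characters *)

Section SubleadingCoefficient.

Variable F : finFieldType.
Implicit Types f g h : {poly F}.

(* The coefficient of X^(deg f - 1), read as 0 when f = 1. *)
Definition subcoef f := ('X * f)`_(size f).-1.

Lemma subcoef1 : subcoef 1 = 0.
Proof. by rewrite /subcoef size_poly1 coefXM. Qed.

(** With d = deg f and e = deg g, only the indices d and d + 1 of X f contribute to the coefficient
    of index d + e + 1 in (X f)(X g), and the leading coefficients are 1. The extra factors X treat
    constants uniformly. *)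
Lemma subcoefM f g :
  f \is monic -> g \is monic -> subcoef (f * g) = subcoef f + subcoef g.
Proof.
move=> mf mg; have [f0 g0] := (monic_neq0 mf, monic_neq0 mg).
rewrite /subcoef size_monicM //.
have sf : size f = (size f).-1.+1 by rewrite prednK // size_poly_gt0.
have sg : size g = (size g).-1.+1 by rewrite prednK // size_poly_gt0.
set d := (size f).-1 in sf *; set e := (size g).-1 in sg *.
have -> : ('X * (f * g))`_(size f + size g).-1.-1
    = ('X * f * ('X * g))`_((d + e).+1).
  have -> : (size f + size g).-1.-1 = (d + e)%N by rewrite sf sg addnS addSn.
  have -> : 'X * f * ('X * g) = 'X * ('X * (f * g)) by ring.
  by rewrite [RHS]coefXM.
have sXf : size ('X * f) = d.+2 by rewrite mulrC size_mulX // sf.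
have sXg : size ('X * g) = e.+2 by rewrite mulrC size_mulX // sg.
have lead k (u : {poly F}) : u \is monic -> size u = k.+1 -> ('X * u)`_k.+1 = 1.
  by move=> /monicP mu su; rewrite coefXM /= -mu lead_coefE su.
rewrite coefM -(big_mkord xpredT
  (fun j => ('X * f)`_j * ('X * g)`_((d + e).+1 - j))).
rewrite (@big_cat_nat _ _ _ d) //=; last by lia.
rewrite big_nat big1 ?add0r; last first.
  move=> i /andP[_ ltid]; rewrite [X in _ * X]nth_default ?mulr0 // sXg; lia.
rewrite (@big_cat_nat _ _ _ d.+2) //=; [|by lia|by lia].
rewrite [X in _ + X]big_nat [X in _ + X]big1 ?addr0; last first.
  by move=> i /andP[ltdi _]; rewrite nth_default ?mul0r // sXf.
rewrite big_nat_recl // big_nat1 (lead d f mf sf) mul1r.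
have -> : ((d + e).+1 - d = e.+1)%N by lia.
have -> : ((d + e).+1 - d.+1 = e)%N by lia.
by rewrite (lead e g mg sg) mulr1.
Qed.

(** Strong induction on the size: an irreducible f is made monic, any other f has a smaller
    nonconstant divisor. *)
Lemma monic_irr_factor f : (1 < size f)%N -> exists2 h, is_irr h & h %| f.
Proof.
have [n] := ubnP (size f); elim: n f => // n IHn f ltfn sf.
have [irrf|] := boolP (irreducibleb f).
  have f0 : f != 0 by rewrite -size_poly_gt0 ltnW.
  have c0 : (lead_coef f)^-1 != 0 by rewrite invr_eq0 lead_coef_eq0.
  have ef : (lead_coef f)^-1 *: f %= f by rewrite eqp_scale.
  exists ((lead_coef f)^-1 *: f); last by rewrite dvdpZl.
  apply/andP; split; first by rewrite monicE lead_coefZ mulVf // lead_coef_eq0.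
  apply/irreducibleP; move/irreducibleP: irrf => [s1 P]; split.
    by rewrite size_scale.
  by move=> q sq; rewrite (eqp_dvdr _ ef) => /(P q sq) /eqp_trans -> //;
    rewrite eqp_sym.
(* [irreducibleb] quantifies over polynomials of size below that of f, which gives the descent. *)
rewrite /irreducibleb sf /= => /forallPn[q].
rewrite negb_imply -ltnNge -Pdiv.Idomain.dvdpE => /andP[qf sq].
have [|h hP hq] := IHn q _ sq; last by exists h => //; exact: dvdp_trans hq qf.
by apply: leq_ltn_trans (size_npoly q) _; rewrite prednK // (ltnW sf).
Qed.

Lemma size_monics n : size (monics F n) = (#|F| ^ n)%N.
Proof.
rewrite -card_npoly cardE -(size_map (fun r => 'X^n + polyn r)).
apply/perm_size/uniq_perm => [||f]; first exact: monics_uniq.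
  rewrite map_inj_uniq ?enum_uniq // => x y /addrI; exact: val_inj.
rewrite mem_monics; apply/andP/mapP => [[/eqP sf mf]|[r _ ->]].
  have sr : f - 'X^n \is a poly_of_size n.
    rewrite qualifE /=; apply/leq_sizeP => j lenj.
    rewrite coefB coefXn; have [->|nejn] := eqVneq j n.
      by rewrite -(monicP mf) lead_coefE sf subrr.
    by rewrite subr0 nth_default // sf ltn_neqAle eq_sym nejn.
  by exists (NPoly sr); rewrite ?mem_enum //= addrC subrK.
have sr : (size (polyn r) < size ('X^n : {poly F}))%N.
  by rewrite size_polyXn ltnS size_npoly.
by rewrite size_polyDl // size_polyXn monicE lead_coefDl // lead_coefXn.
Qed.

Lemma mons0 : monics F 0 = [:: 1].
Proof.
apply/perm_small_eq => //; apply: uniq_perm => [||f]; rewrite ?monics_uniq //.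
rewrite mem_monics inE; apply/andP/eqP => [[/eqP sf /monicP mf]|->].
  have/size_poly1P[c _ fc] : size f == 1%N by rewrite sf.
  by rewrite fc lead_coefC in mf; rewrite fc mf.
by rewrite size_poly1 monic1.
Qed.

End SubleadingCoefficient.

Section AdditiveCharacters.

Variables (F : finFieldType) (K : numFieldType).

Record additive_char (psi : F -> K) : Prop := AdditiveChar {
  additive_char0 : psi 0 = 1;
  additive_charD : {morph psi : x y / x + y >-> x * y} }.

Definition chi (psi : F -> K) (f : {poly F}) := psi (subcoef f).

Variable psi : F -> K.
Hypothesis psiP : additive_char psi.

Lemma chi1 : chi psi 1 = 1.
Proof. by rewrite /chi subcoef1 additive_char0. Qed.

Lemma chiM f g : f \is monic -> g \is monic ->
  chi psi (f * g) = chi psi f * chi psi g.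
Proof. by move=> mf mg; rewrite /chi subcoefM // additive_charD. Qed.

Lemma sum_chi_trivial n : (forall x, psi x = 1) ->
  \sum_(f <- monics F n) chi psi f = #|F|%:R ^+ n.
Proof.
move=> psi1; under eq_bigr do rewrite /chi psi1.
by rewrite big_const_seq count_predT size_monics iter_addr_0 natrX.
Qed.

(* Adding c to the subleading coefficient permutes the monic polynomials. *)
Lemma sum_chi_nontrivial n c : psi c != 1 ->
  \sum_(f <- monics F n) chi psi f = (n == 0)%:R.
Proof.
move=> psic; case: n => [|n]; first by rewrite mons0 big_seq1 chi1.
set S := \sum_(_ <- _) _.
suff e : S = psi c * S.
  have /eqP : (1 - psi c) * S = 0 by rewrite mulrBl mul1r -e subrr.
  by rewrite mulf_eq0 subr_eq0 eq_sym (negbTE psic) => /eqP.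
have sr (f : {poly F}) : size f = n.+2 -> (size (c *: 'X^n) < size f)%N.
  by move=> ->; rewrite ltnS (leq_trans (size_scale_leq _ _)) // size_polyXn.
rewrite [LHS](perm_big [seq f + c *: 'X^n | f <- monics F n.+1]) /=.
  rewrite big_map big_distrr big_seq [RHS]big_seq; apply: eq_bigr => f.
  rewrite mem_monics => /andP[/eqP sf mf].
  rewrite /chi /subcoef size_polyDl ?sr // sf /= !coefXM /= coefD coefZ coefXn.
  by rewrite eqxx mulr1 additive_charD // mulrC.
apply: uniq_perm => [||f]; first exact: monics_uniq.
  by rewrite map_inj_uniq ?monics_uniq // => x y /addIr.
have mD (d : F) g : g \in monics F n.+1 -> g + d *: 'X^n \in monics F n.+1.
  rewrite !mem_monics => /andP[/eqP sg mg].
  have ltg : (size (d *: 'X^n) < size g)%N.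
    by rewrite sg ltnS (leq_trans (size_scale_leq _ _)) // size_polyXn.
  by rewrite size_polyDl // sg eqxx monicE lead_coefDl // -monicE.
apply/idP/mapP => [fn|[g gn ->]]; last exact: mD.
exists (f + (- c) *: 'X^n); first exact: mD.
by rewrite scaleNr subrK.
Qed.

Lemma chi_twisted s : {in s, forall h : {poly F}, is_irr h} ->
  twisted (chi psi) s (chi psi).
Proof. by move=> Ps h f hs mf; have /andP[mh _] := Ps h hs; rewrite chiM. Qed.

Definition psum i k := \sum_(h <- irreds F i) chi psi h ^+ k.

(** Forbidding irreducible factors of degrees 1 to N - 1 leaves only the polynomial 1 below degree
    N, so the Euler factors times the L-series give 1. *)
Lemma euler_product N : (0 < N)%N ->
  eqX N (\prod_(i <- iota 1 N.-1) \prod_(h <- irreds F i)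
           (1 - chi psi h *: 'X^i) * series N (chi psi)) 1.
Proof.
move=> N0; apply: eqX_sym.
have Ps i : {in irreds F i, forall h : {poly F}, size h = i.+1 /\ is_irr h}.
  by move=> h; rewrite mem_irreds => /andP[/eqP].
have := @series_prod_mult_sum F K N (chi psi) _ (iota 1 N.-1) (irreds F) id
  (fun=> 0%N) (chi psi) (@irreds_uniq F) Ps (@inj_id _) (iota_uniq _ _)
  (fun i => chi_twisted (fun h hi => proj2 (Ps i h hi))) (fun=> N0).
under eq_bigr do rewrite complete0 // scale1r muln0 mul1r.
apply: eqX_trans => n ltnN; rewrite coef_poly ltnN coef1.
case: n ltnN => [|n] ltnN.
  rewrite mons0 big_seq1 chi1 mulr1 eqxx; congr (nat_of_bool _)%:R.
  apply/esym/allP => i _; rewrite sum_nat_seq_eq0; apply/allP => h /Ps[_ Ph].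
  rewrite /= multiplicity_eq0 ?oner_eq0 // dvdp1.
  by rewrite neq_ltn (is_irr_size Ph) orbT.
rewrite big_seq big1 // => f; rewrite mem_monics => /andP[/eqP sf mf].
rewrite [all _ _](_ : _ = false) ?mul0r //; apply/negbTE/allPn.
have [|h Ph hf] := @monic_irr_factor _ f; first by rewrite sf.
have f0 := monic_neq0 mf; have sh := is_irr_size Ph.
have lesh := dvdp_leq f0 hf; exists (size h).-1.
  by rewrite mem_iota; move: sh lesh; rewrite sf; move: (size h) => k; lia.
rewrite /mult_sum (big_rem h) /=.
  by rewrite addn_eq0 multiplicity_eq0 // hf.
by rewrite mem_irreds Ph prednK ?eqxx // ltnW.
Qed.

End AdditiveCharacters.

(** * Power sums of character values over irreducible polynomials *)

Lemma divisors_sum_inj (V : zmodType) (f g : nat -> V) :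
  (forall n, (0 < n)%N ->
     \sum_(i <- divisors n) f i = \sum_(i <- divisors n) g i) ->
  forall n, (0 < n)%N -> f n = g n.
Proof.
move=> fg n; elim/ltn_ind: n => n IHn n0; have := fg n n0.
rewrite (bigD1_seq n) ?divisors_uniq -?dvdn_divisors //=.
rewrite [RHS](bigD1_seq n) ?divisors_uniq -?dvdn_divisors //=.
rewrite big_seq_cond [in RHS]big_seq_cond (eq_bigr g); first exact: addIr.
move=> i /andP[]; rewrite -dvdn_divisors // => din nein.
by apply: IHn; [rewrite ltn_neqAle nein dvdn_leq | exact: dvdn_gt0 din].
Qed.

Section PowerSums.

Variables (F : finFieldType) (K : numFieldType) (psi : F -> K).
Hypothesis psiP : additive_char psi.

Lemma newton_lin_prod N i : (0 < i)%N ->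
  newton N (\sum_(h <- irreds F i) i%:R * (- powers N (chi psi h) \Po 'X^i))
           (\prod_(h <- irreds F i) (1 - chi psi h *: 'X^i)).
Proof.
move=> i0; apply: newton_prod => h _.
have -> : 1 - chi psi h *: 'X^i = (1 - chi psi h *: 'X) \Po 'X^i.
  by rewrite comp_polyB comp_polyC comp_polyZ comp_polyX.
exact: newton_comp_Xn i0 (newton_lin _ _).
Qed.

Lemma coef_natl (R : nzRingType) (P : {poly R}) m n :
  (m%:R * P)`_n = m%:R * P`_n.
Proof. by rewrite !mulr_natl coefMn. Qed.

(** The Euler factors of degree at most n and the L-series multiply to 1, so their power sums add up
    to 0. At index n, a degree i dividing n contributes -i [psum psi i (n %/ i)]; the other degrees
    contribute nothing. *)
Lemma sum_divisors_psum n S : (0 < n)%N ->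
  newton n.+1 S (series n.+1 (chi psi)) ->
  \sum_(i <- divisors n) i%:R * psum psi i (n %/ i) = S`_n.
Proof.
move=> n0 newtS.
have newtT := @newton_prod K n.+1 _ (iota 1 n)
  (fun i => \sum_(h <- irreds F i) i%:R * (- powers n.+1 (chi psi h) \Po 'X^i))
  (fun i => \prod_(h <- irreds F i) (1 - chi psi h *: 'X^i)).
have {}newtT := newtT (fun i iP => newton_lin_prod _ (proj1 (andP
  (etrans (esym (mem_iota 1 n i)) iP)))).
have eq1 := euler_product psiP (ltn0Sn n).
have /(newton_eqXr (ltn0Sn n) eq1) newt1 := newtonM newtT newtS.
have := newton_inj newt1 (newton1 K n.+1) (ltnSn n).
rewrite coefD coef0 => /eqP; rewrite addrC addr_eq0 => /eqP ->.
rewrite coef_sum -sumrN (perm_big [seq i <- iota 1 n | (i %| n)%N]).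
  rewrite big_filter big_mkcond; apply: eq_big_seq => i /=.
  rewrite mem_iota => /andP[i0 _].
  rewrite coef_sum /psum mulr_sumr; case: ifP => din.
    rewrite -sumrN; apply: eq_bigr => h _.
    rewrite coef_natl coef_comp_poly_Xn // din coefN coef_powers.
      by rewrite divn_gt0 // dvdn_leq // mulr1n mulrN opprK.
    by rewrite ltnS leq_div.
  rewrite big1 ?oppr0 // => h _.
  by rewrite coef_natl coef_comp_poly_Xn // din mulr0.
apply: uniq_perm; rewrite ?divisors_uniq ?filter_uniq ?iota_uniq // => i.
rewrite -dvdn_divisors // mem_filter mem_iota add1n ltnS andbC.
case: (boolP (i %| n)%N) => din; rewrite ?andbF // andbT.
by rewrite (dvdn_gt0 n0 din) dvdn_leq.
Qed.

Lemma sum_divisors_psum_trivial n : (0 < n)%N -> (forall x, psi x = 1) ->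
  \sum_(i <- divisors n) i%:R * psum psi i (n %/ i) = #|F|%:R ^+ n.
Proof.
move=> n0 psi1; rewrite (@sum_divisors_psum n (powers n.+1 #|F|%:R)) //.
  by rewrite coef_powers // n0.
apply: newton_eqXr (newton_geometric _ (ltn0Sn n)) => // k ltkn.
by rewrite coef_geometric // coef_poly ltkn sum_chi_trivial.
Qed.

Lemma sum_divisors_psum_nontrivial n c : (0 < n)%N -> psi c != 1 ->
  \sum_(i <- divisors n) i%:R * psum psi i (n %/ i) = 0.
Proof.
move=> n0 psic; rewrite (@sum_divisors_psum n 0) ?coef0 //.
apply: newton_eqXr (newton1 _ _) => // k ltkn.
by rewrite coef1 coef_poly ltkn (sum_chi_nontrivial _ _ psic).
Qed.

End PowerSums.

(** For the trivial character every power sum is the number of irreducibles, so both sides have the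
    divisor sums q^n, which determine them. *)
Lemma card_monic_irr (F : finFieldType) n : (0 < n)%N ->
  n%:R * #|monic_irr F n|%:R = necklace #|F| n.
Proof.
move: n; apply: divisors_sum_inj => n n0; rewrite sum_necklace //.
have triv : additive_char (fun _ : F => 1 : rat).
  by split=> // x y; rewrite mulr1.
rewrite -(sum_divisors_psum_trivial triv n0) //; apply: eq_bigr => i _.
rewrite /psum /chi; under [in RHS]eq_bigr do rewrite expr1n.
by rewrite big_const_seq count_predT size_irreds iter_addr_0.
Qed.

Section NontrivialCharacters.

Variables (F : finFieldType) (K : numFieldType) (p e : nat).
Hypotheses (p_prime : prime p) (card_F : #|F| = (p ^ e)%N).

Definition nontrivial (psi : F -> K) :=
  additive_char psi /\ exists c, psi c != 1.

Lemma additive_char_exp (psi : F -> K) x : additive_char psi -> psi x ^+ p = 1.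
Proof.
move=> [psi0 psiD].
have e_gt0 : (0 < e)%N.
  by case: e card_F => // F1; have := finNzRing_gt1 F; rewrite F1.
have e0 n : psi (x *+ n) = psi x ^+ n.
  by elim: n => [|n IHn]; rewrite ?mulr0n ?expr0 // mulrS psiD exprS IHn.
by rewrite -e0 (mulrn_pchar (card_finPcharP card_F p_prime)) psi0.
Qed.

(** By Bezout, psi(c)^k = 1 together with psi(c)^p = 1 would force psi(c) = 1. *)
Lemma nontrivial_exp psi k : nontrivial psi -> ~~ (p %| k)%N ->
  nontrivial (fun x => psi x ^+ k).
Proof.
move=> [psiP [c psic]] npk; split.
  have [psi0 psiD] := psiP; split=> [|x y]; first by rewrite psi0 expr1n.
  by rewrite psiD exprMn.
exists c; apply: contra psic => /eqP ck; have cp := additive_char_exp c psiP.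
have k0 : (0 < k)%N by case: k npk {ck} => //; rewrite dvdn0.
have [u v /eqP e1 _] := egcdnP p k0.
have -> : psi c = psi c ^+ (v * p + gcdn k p).
  by rewrite exprD mulnC exprM cp expr1n mul1r (eqP (_ : coprime k p)) //
    coprime_sym prime_coprime.
by rewrite -(eqP e1) mulnC exprM ck expr1n.
Qed.

Lemma psum_dvd (psi : F -> K) i k : additive_char psi -> (p %| k)%N ->
  psum psi i k = #|monic_irr F i|%:R.
Proof.
move=> psiP /dvdnP[k' ->]; rewrite -size_irreds /psum.
under eq_bigr do rewrite /chi mulnC exprM additive_char_exp // expr1n.
by rewrite big_const_seq count_predT iter_addr_0.
Qed.

(* psum psi i k = psum psi^k i 1, where psi^k is nontrivial when p does not
   divide k and trivial otherwise, so that induction on n applies to the terms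
   i < n of sum_divisors_psum_nontrivial. *)
Lemma psum_nontrivial1 n (psi : F -> K) : (0 < n)%N -> nontrivial psi ->
  n%:R * psum psi n 1 = ratr (necklace_p p #|F| n).
Proof.
elim/ltn_ind: n psi => n IHn psi n0 psiN; have [psiP [c psic]] := psiN.
have := congr1 (@ratr K) (sum_necklace_p #|F| p_prime n0).
rewrite rmorph_sum rmorph0.
move=> /esym /(etrans (sum_divisors_psum_nontrivial psiP n0 psic)).
rewrite (bigD1_seq n) ?divisors_uniq -?dvdn_divisors //= divnn n0.
rewrite [RHS](bigD1_seq n) ?divisors_uniq -?dvdn_divisors //= divnn n0.
rewrite dvdn1 gtn_eqF ?prime_gt1 //.
rewrite big_seq_cond [in RHS]big_seq_cond.
set S := \sum_(_ <- _ | _) _; set S' := \sum_(_ <- _ | _) _.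
suff -> : S = S' by exact: addIr.
apply: eq_bigr => i /andP[]; rewrite -dvdn_divisors // => din nein.
have i0 := dvdn_gt0 n0 din.
have ltin : (i < n)%N by rewrite ltn_neqAle nein dvdn_leq.
case: ifP => [pni|/negbT pni].
  by rewrite psum_dvd // -card_monic_irr // rmorphM !rmorph_nat.
by rewrite -(IHn i ltin _ i0 (nontrivial_exp psiN pni)).
Qed.

(** If p divides k, all k-th powers are 1 and the sum counts irreducibles. Otherwise it is the first
    power sum of the nontrivial character psi^k. *)
Lemma psum_nontrivial (psi : F -> K) i k : (0 < i)%N -> nontrivial psi ->
  psum psi i k = ratr (b_num p #|F| i + a_num p #|F| i * #|F|%:R *+ (p %| k)%N).
Proof.
move=> i0 psiN; have [psiP _] := psiN.
have iK : i%:R != 0 :> K by rewrite pnatr_eq0 -lt0n.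
have iQ : i%:R != 0 :> rat by rewrite pnatr_eq0 -lt0n.
have qQ : #|F|%:R != 0 :> rat by rewrite pnatr_eq0 -lt0n ltnW ?finNzRing_gt1.
have ib : i%:R * b_num p #|F| i = necklace_p p #|F| i by rewrite mulrC divfK.
have iab : i%:R * (b_num p #|F| i + a_num p #|F| i * #|F|%:R)
    = necklace #|F| i.
  rewrite mulrDr ib /necklace (bigID (dvdn p)) /a_num; congr (_ + _).
  by field; rewrite iQ qQ.
apply: (mulfI iK); have [pk|npk] := boolP (p %| k)%N.
  transitivity (@ratr K (i%:R * #|monic_irr F i|%:R)).
    by rewrite psum_dvd // rmorphM !rmorph_nat.
  by rewrite card_monic_irr // -iab mulr1n rmorphM rmorph_nat.
rewrite mulr0n addr0 -[i%:R in RHS](rmorph_nat (@ratr K)) -rmorphM ib.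
exact: etrans _ (psum_nontrivial1 i0 (nontrivial_exp psiN npk)).
Qed.

End NontrivialCharacters.

(** * Expansion of the weighted counts *)

(** Distributivity when the range of summation depends on i; passing through [fprod] reduces it to
    sums over tagged values. *)
Lemma prod_sum_dffun (R : comNzRingType) (I : finType) (J : I -> finType)
    (G : forall i, J i -> R) :
  \prod_i \sum_(j : J i) G i j
  = \sum_(f : {dffun forall i, J i}) \prod_i G i (f i).
Proof.
rewrite [RHS](reindex (@dffun_of_fprod I J)); last first.
  exact: onW_bij (dffun_of_fprod_bij J).
transitivity (\sum_(t : fprod J) \prod_i [ffun j => G i j] (t i)); last first.
  by apply: eq_bigr => t _; apply: eq_bigr => i _; rewrite !ffunE.
rewrite big_fprod -(bigA_distr_big_dep (fun i => tagged_with J i)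
  (fun i => untag 0 [ffun j => G i j])).
apply: eq_bigr => i _; rewrite -(big_tag (fun i => [ffun j => G i j])).
by apply: eq_bigr => j _; rewrite ffunE.
Qed.

Section RatrSeries.

Variables (K : numFieldType) (N : nat).

Notation ratp := (map_poly (@ratr K)).

Lemma eqX_ratr P Q : eqX N P Q -> eqX N (ratp P) (ratp Q).
Proof. by move=> PQ n ltnN; rewrite !coef_map /= PQ. Qed.

Lemma newton_ratr S C : newton N S C -> newton N (ratp S) (ratp C).
Proof.
move=> [C0 SC]; split; first by rewrite coef_map /= C0 rmorph1.
by rewrite deriv_map -(map_polyX (@ratr K)) -!rmorphM /=; exact: eqX_ratr.
Qed.

(** The bound [b] serves both a series cut at order [N] and a polynomial whose higher coefficients
    vanish. *)
Lemma comp_Xn_sum (C : {poly K}) (c : nat -> K) (i b : nat) : (0 < i)%N ->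
  (forall n, (n < N)%N -> C`_n = if (n < b)%N then c n else 0) ->
  eqX N (C \Po 'X^i) (\sum_(j < b) c j *: 'X^(i * j)).
Proof.
move=> i0 Cc n ltnN; rewrite coef_comp_poly_Xn // coef_sum.
under eq_bigr do rewrite coefZ coefXn.
case: ifP => [/dvdnP[k def_n]|nin]; last first.
  rewrite big1 // => j _; case: eqP => [e|_]; last by rewrite mulr0.
  by rewrite e dvdn_mulr in nin.
rewrite def_n mulnK // Cc; last first.
  by rewrite (leq_ltn_trans _ ltnN) // def_n leq_pmulr.
case: ltnP => [ltkb|lebk].
  rewrite (bigD1 (Ordinal ltkb)) //= mulnC eqxx mulr1 big1 ?addr0 // => j nejk.
  rewrite eqn_pmul2l // [_ == _]negbTE ?mulr0 // eq_sym.
  exact: nejk.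
rewrite big1 // => j _; rewrite mulnC eqn_pmul2l // gtn_eqF ?mulr0 //.
exact: leq_trans lebk.
Qed.

End RatrSeries.

Lemma prod_monomials (R : comNzRingType) (I : finType) (c : I -> R)
    (d : I -> nat) :
  \prod_i (c i *: 'X^(d i)) = (\prod_i c i) *: 'X^(\sum_i d i)%N.
Proof. by rewrite scaler_prod prodrXr. Qed.

Lemma gbin_series_negate N x n : (n < N)%N ->
  (gbin_series N (- x))`_n = gbin x n * (-1) ^+ n.
Proof. by move=> ltnN; rewrite coef_poly ltnN gbin_negate. Qed.

Lemma gbin_small (n k : nat) : (n < k)%N -> gbin n%:R k = 0.
Proof.
move=> ltnk; rewrite /gbin (bigD1 (Ordinal ltnk)) //= subrr !mul0r //.
Qed.

Section WeightedCount.

Variables (F : finFieldType) (K : numFieldType) (psi : F -> K).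
Hypothesis psiP : additive_char psi.
Variables (T : finType) (d l : T -> nat) (N m : nat).
Hypotheses (d_inj : injective d) (d_gt0 : forall i, (0 < d i)%N).
Hypotheses (l_lt : forall i, (l i < N)%N) (m_lt : (m < N)%N).
Variables (s : T -> nat -> rat) (B C : T -> {poly rat}) (D : {poly rat}).
Hypothesis psumE : forall i k, psum psi (d i) k = ratr (s i k).

Let S i : {poly rat} := \poly_(k < N) (s i k *+ (0 < k)%N).
Hypotheses (newtonB : forall i, newton N (S i) (B i)).
Hypotheses (newtonC : forall i, newton N (- S i) (C i)).
Hypothesis seriesD :
  eqX N (series N (chi psi)) (map_poly (@ratr K) D).

(** A series is determined by its power sums, so [B i] and [C i] map to the complete symmetric
    series and to the product of the 1 - chi(h) X. The count thus depends on psi only through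
    rational power sums and the L-series, and is itself rational. *)
Lemma weighted_count :
  \sum_(f <- monics F m)
     [forall i, nb_irr_factors (d i) f == l i]%:R * chi psi f
  = ratr ((\prod_i ((B i)`_(l i) *: 'X^(d i * l i) * (C i \Po 'X^(d i)))
           * D)`_m).
Proof.
have N0 : (0 < N)%N by exact: leq_ltn_trans m_lt.
pose Q i := \prod_(h <- irreds F (d i)) (1 - chi psi h *: 'X).
have powers_psum i : \sum_(h <- irreds F (d i)) powers N (chi psi h)
    = map_poly (@ratr K) (S i).
  apply/polyP => n; rewrite coef_sum coef_map coef_poly /=.
  have [ltnN|leNn] := ltnP n N; last first.
    by rewrite rmorph0 big1 // => h _; rewrite coef_poly ltnNge leNn.
  rewrite rmorphMn /= -psumE /psum -sumrMnl; apply: eq_bigr => h _.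
  exact: coef_powers.
have S0 i : (map_poly (@ratr K) (S i))`_0 = 0.
  by rewrite coef_map coef_poly N0 /= mulr0n rmorph0.
have completeE i : eqX N (complete N (chi psi) (irreds F (d i)))
    (map_poly (@ratr K) (B i)).
  apply: (newton_uniq (S0 i)); last exact: newton_ratr.
  by rewrite -powers_psum; apply: newton_prod => h _; exact: newton_geometric.
have QE i : eqX N (Q i) (map_poly (@ratr K) (C i)).
  have S0' : (- map_poly (@ratr K) (S i))`_0 = 0 by rewrite coefN S0 oppr0.
  apply: (newton_uniq S0'); last by rewrite -rmorphN; exact: newton_ratr.
  by rewrite -powers_psum -sumrN; apply: newton_prod => h _; exact: newton_lin.
have Ps i :
    {in irreds F (d i), forall h : {poly F}, size h = (d i).+1 /\ is_irr h}.
  by move=> h; rewrite mem_irreds => /andP[/eqP].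
have := @series_prod_mult_sum F K N (chi psi) T (index_enum T)
  (fun i => irreds F (d i)) d l (chi psi) (fun i => irreds_uniq F (d i)) Ps
  d_inj (index_enum_uniq T)
  (fun i => chi_twisted psiP (fun h hi => proj2 (Ps i h hi))) l_lt.
move=> /(_ m m_lt); rewrite coef_poly m_lt => e.
transitivity (\sum_(f <- monics F m)
  (all (fun i => mult_sum (irreds F (d i)) f == l i) (index_enum T))%:R
  * chi psi f).
  apply: eq_bigr => f _; congr ((nat_of_bool _)%:R * _).
  apply/forallP/allP => [H i _|H i]; first by rewrite -nb_irr_factorsE.
  by rewrite nb_irr_factorsE H // mem_index_enum.
rewrite {}e -coef_map /= rmorphM rmorph_prod.
apply: (eqXM _ seriesD m_lt); apply: eqX_prod => i.
rewrite rmorphM /= map_polyZ map_polyXn; apply: eqXM.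
  by rewrite completeE // coef_map; exact: eqX_refl.
rewrite map_comp_poly map_polyXn.
have -> : \prod_(h <- irreds F (d i)) (1 - chi psi h *: 'X^(d i))
    = Q i \Po 'X^(d i).
  rewrite /Q rmorph_prod; apply: eq_bigr => h _ /=.
  by rewrite comp_polyB comp_polyC comp_polyZ comp_polyX.
by apply: eqX_comp_Xn.
Qed.

End WeightedCount.

Section Expansion.

Variables (T : finType) (d l : T -> nat) (N m : nat).
Hypotheses (d_gt0 : forall i, (0 < d i)%N) (m_lt : (m < N)%N).
Variables (beta : T -> rat) (C : T -> {poly rat}) (D : {poly rat}).

Let G := (\prod_i (beta i *: 'X^(d i * l i) * (C i \Po 'X^(d i))) * D)`_m.

Lemma coef_prod_comp (b : T -> nat) (c : T -> nat -> rat) :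
  (forall i n, (n < m.+1)%N -> (C i)`_n = if (n < b i)%N then c i n else 0) ->
  G = ((\prod_i \sum_(j < b i)
          (beta i * c i j) *: 'X^(d i * (l i + j))) * D)`_m.
Proof.
move=> Cc; apply: (@eqXM _ m.+1 _ _ _ _ _ (eqX_refl D)) => //.
apply: eqX_prod => i; have e := comp_Xn_sum (d_gt0 i) (@Cc i).
apply: eqX_trans (eqXM (eqX_refl _) e) _.
rewrite mulr_sumr (eq_bigr (fun j : 'I_(b i) =>
  (beta i * c i j) *: 'X^(d i * (l i + j)))) // => j _.
by rewrite -scalerAl -scalerAr scalerA mulnDr exprD.
Qed.

(** With D = 1 only products of total degree exactly m remain, and each [C i] matters only up to
    degree m. *)
Lemma coef_prod_ffun : D = 1 ->
  G = \sum_(k : {ffun T -> 'I_m.+1})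
        (\sum_i d i * (l i + k i) == m)%N%:R
        * \prod_i (beta i * (C i)`_(k i)).
Proof.
move=> D1; rewrite (@coef_prod_comp (fun=> m.+1) (fun i n => (C i)`_n)).
  rewrite D1 mulr1 bigA_distr_bigA coef_sum; apply: eq_bigr => k _.
  by rewrite prod_monomials coefZ coefXn mulrC eq_sym.
by move=> i n ->.
Qed.

(** A product of degree t at most m is completed by the coefficient Q^(m - t) of D, whence an
    inequality on degrees. Up to degree m, the bound [b i] exhausts the nonzero coefficients of
    [C i]. *)
Lemma coef_prod_dffun (b : T -> nat) (c : T -> nat -> rat) (Q : rat) :
  (forall i n, (n < m.+1)%N -> (C i)`_n = if (n < b i)%N then c i n else 0) ->
  (forall n, (n <= m)%N -> D`_n = Q ^+ n) ->
  G = \sum_(j : {dffun forall i, 'I_(b i)})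
        (\sum_i d i * (l i + j i) <= m)%N%:R
        * (\prod_i (beta i * c i (j i)) * Q ^+ (m - \sum_i d i * (l i + j i))).
Proof.
move=> Cc DQ; rewrite (coef_prod_comp Cc).
rewrite (prod_sum_dffun (J := fun i => 'I_(b i))
  (fun i (j : 'I_(b i)) => (beta i * c i j) *: 'X^(d i * (l i + j)))).
rewrite mulr_suml coef_sum; apply: eq_bigr => j _.
rewrite prod_monomials -scalerAl coefZ coefXnM ltnNge.
case: leqP => _ /=; last by rewrite mulr0 mul0r.
by rewrite DQ ?leq_subr // mul1r.
Qed.

End Expansion.

(** * Complex characters of the additive group and orthogonality *)

Section ComplexCharacters.

Variable F : finFieldType.

Let G : {group F} := [set: F]%G.

Definition addchar (i : Iirr G) (x : F) : algC := 'chi_i x.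

Lemma lin_addchar i : 'chi[G]_i \is a linear_char.
Proof. exact/char_abelianP/FinRing.zmod_abelian. Qed.

Lemma addcharP i : additive_char (addchar i).
Proof.
have li := lin_addchar i; split; first exact: lin_char1.
by move=> x y; rewrite /addchar -(lin_charM li) ?inE.
Qed.

Lemma addchar0 x : addchar 0 x = 1.
Proof. by rewrite /addchar irr0 cfun1E inE. Qed.

Lemma addchar_nontrivial i : i != 0 -> nontrivial (addchar i).
Proof.
move=> i0; split; first exact: addcharP.
have [/existsP //|/existsPn H] := boolP [exists c, addchar i c != 1].
case/eqP: i0; apply: irr_inj; apply/cfunP => x.
by have := H x; rewrite negbK -(addchar0 x) => /eqP.
Qed.

(** Second orthogonality: in an abelian group centralizers are the whole group and classes are
    points, and the conjugate of psi(y) is psi(-y). *)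
Lemma addchar_orthogonality x y :
  \sum_i addchar i x * addchar i (- y) = #|F|%:R *+ (x == y).
Proof.
transitivity (\sum_i 'chi[G]_i x * ('chi[G]_i y)^*).
  by apply: eq_bigr => i _; rewrite -(lin_charV_conj (lin_addchar i)) ?inE.
rewrite second_orthogonality_relation ?inE //.
have abG : abelian G by exact: FinRing.zmod_abelian.
have -> : ('C_G[x] = G)%g.
  by apply/setIidPl; rewrite sub_cent1 (subsetP abG) ?inE.
rewrite cardsT; congr (_ *+ (nat_of_bool _)).
apply/imsetP/eqP => [[z _ ->]|->].
  by rewrite conjgE !FinRing.zmodMgE FinRing.zmodVgE addrCA addNr addr0.
by exists 1%g; rewrite ?inE ?conjg1.
Qed.

End ComplexCharacters.

(** * The count as an average over characters *)

Lemma subcoef_monics (F : finFieldType) m (f : {poly F}) :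
  (0 < m)%N -> f \in monics F m -> subcoef f = f`_m.-1.
Proof.
move=> m0; rewrite mem_monics => /andP[/eqP sf _].
by rewrite /subcoef sf coefXM; case: m m0 {sf}.
Qed.

Lemma Nstar_sum (F : finFieldType) (m : nat) (T : {fset nat}) (l : T -> nat)
    (alpha : F) : (0 < m)%N ->
  (Nstar m l alpha)%:R = \sum_(f <- monics F m)
     [forall i, nb_irr_factors (val i) f == l i]%:R *+ (subcoef f == alpha)
  :> algC.
Proof.
move=> m0; rewrite /Nstar -sum1_card natr_sum.
rewrite /monics big_image /= big_mkcond [RHS]big_mkcond.
apply: eq_bigr => g _; rewrite inE.
case: (boolP (g \in _)) => [gP|]; last first.
  by rewrite inE; case: (size g == m.+1) => //=; case: (_ \is monic).
have /andP[sg mg] := gP; rewrite sg mg /=.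
rewrite (@subcoef_monics _ m) //; last by rewrite mem_monics sg mg.
by case: (_ == alpha); case: [forall i, _].
Qed.

Lemma coef_gbin_series (N n : nat) x : (n < N)%N ->
  (gbin_series N x)`_n = gbin (x + n%:R - 1) n.
Proof. by move=> ltnN; rewrite coef_poly ltnN. Qed.

Lemma gbin_series_nat (N n k : nat) : (k < N)%N ->
  (gbin_series N (- n%:R))`_k
  = if (k < n.+1)%N then gbin n%:R k * (-1) ^+ k else 0.
Proof.
move=> ltkN; rewrite gbin_series_negate //; case: ltnP => // ltnk.
by rewrite gbin_small // mul0r.
Qed.

(* In the second sum a tuple with \sum_i i * (l i + k i) = m has every
   k i <= m because every i in T is positive; hence k i : 'I_m.+1. *)
Theorem theorem6 (F : finFieldType) (p e q : nat)
    (p_prime : prime p) (e_gt0 : (0 < e)%N) (q_def : q = (p ^ e)%N)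
    (card_F : #|F| = q)
    (T : {fset nat}) (T_pos : forall i : nat, i \in T -> (1 <= i)%N)
    (m : nat) (m_gt0 : (1 <= m)%N) (l : T -> nat) (alpha : F) :
  (Nstar m l alpha)%:R =
    q%:R ^+ m.-1 *
      (\sum_(j : {dffun forall i : T, 'I_#|monic_irr F (val i)|.+1})
         (\sum_(i : T) val i * (l i + j i) <= m)%N%:R *
         \prod_(i : T)
           (gbin (#|monic_irr F (val i)|%:R + (l i)%:R - 1) (l i)
            * q%:R ^- (val i * l i)
            * gbin #|monic_irr F (val i)|%:R (j i)
            * (-1) ^+ j i * q%:R ^- (val i * j i)))
    + v q alpha / q%:R *
      (\sum_(k : {ffun T -> 'I_m.+1})
         (\sum_(i : T) val i * (l i + k i) == m)%N%:R *
         \prod_(i : T)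
           (B_num p q (l i) (a_num p q (val i)) (b_num p q (val i))
            * A_num p q (k i) (a_num p q (val i)) (b_num p q (val i))
            * (-1) ^+ k i))
  :> rat.
Proof.
set S0 := \sum_(j : {dffun _}) _; set S1 := \sum_(k : {ffun _}) _.
have q_gt0 : (0 < q)%N by rewrite -card_F ltnW ?finNzRing_gt1.
have q0 : q%:R != 0 :> rat by rewrite pnatr_eq0 -lt0n.
have p_gt0 := prime_gt0 p_prime.
pose d (i : T) := val i; have d_gt0 i : (0 < d i)%N by exact: T_pos (valP i).
have d_inj : injective d by exact: val_inj.
(* One truncation order, above m and above every [l i], serves all the series. *)
have [N m_lt l_lt] : exists2 N, (m < N)%N & forall i, (l i < N)%N.
  exists (m + \sum_i l i).+1 => [|i]; rewrite ltnS ?leq_addr //.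
  by rewrite (bigD1 i) //= addnCA leq_addr.
have N0 : (0 < N)%N by exact: leq_ltn_trans m_lt.
pose W (psi : F -> algC) := \sum_(f <- monics F m)
  [forall i, nb_irr_factors (d i) f == l i]%:R * chi psi f.
(* All power sums equal |I_i|, so the series are (1 - X)^(-|I_i|) and (1 - X)^(|I_i|), and the
   L-series is 1 / (1 - q X). *)
have W_trivial : W (@addchar F 0) = ratr (q%:R ^+ m * S0).
  pose n i : rat := #|monic_irr F (d i)|%:R.
  rewrite /W (@weighted_count F algC _ (addcharP 0) T d l N m d_inj d_gt0 l_lt
    m_lt (fun i _ => n i) (fun i => gbin_series N (n i))
    (fun i => gbin_series N (- n i)) (geometric N q%:R)).
  - congr ratr; rewrite (@coef_prod_dffun T d l m d_gt0 _ _ _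
      (fun i => #|monic_irr F (d i)|.+1)
      (fun i k => gbin (n i) k * (-1) ^+ k) q%:R).
    + rewrite mulr_sumr; apply: eq_bigr => j _.
      case: leqP => [leSm|_]; last by rewrite !mul0r mulr0.
      (* The power q^(m - t) is split as q^m q^(-t), and q^(-t) is distributed over the factors. *)
      rewrite !mul1r exprB ?unitfE // mulrCA; congr (_ * _).
      rewrite -prodrXr -prodfV -big_split; apply: eq_bigr => i _.
      rewrite (coef_gbin_series _ (l_lt i)) mulnDr exprD invfM /n /d /=.
      move: (gbin _ (l i)) (gbin _ (j i)) ((-1) ^+ j i) => g h u.
      ring.
    + move=> i k ltk; rewrite gbin_series_nat //; exact: leq_trans m_lt.
    + by move=> k lek; rewrite coef_geometric // (leq_ltn_trans lek).
  - move=> i k; rewrite rmorph_nat -size_irreds /psum.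
    under eq_bigr do rewrite /chi addchar0 expr1n.
    by rewrite big_const_seq count_predT iter_addr_0.
  - move=> i; apply: newton_eqX (newton_gbin_series _ N0) => k ltkN.
    by rewrite coefZ coef_powers // coef_poly ltkN expr1n mulr_natr.
  - move=> i; apply: newton_eqX (newton_gbin_series _ N0) => k ltkN.
    rewrite coefZ coef_powers // coefN coef_poly ltkN expr1n.
    by rewrite mulr_natr mulNrn.
  - move=> k ltkN; rewrite coef_map coef_geometric // coef_poly ltkN.
    rewrite (sum_chi_trivial _ (@addchar0 F)) card_F.
    by rewrite /= rmorphXn rmorph_nat.
(* The power sums b_i + 1[p | k] q a_i are the same for all nontrivial psi, hence so is the weighted
   count. *)
have W_nontrivial psi : nontrivial psi -> W psi = ratr S1.
  move=> psiN; have [psiP [c psic]] := psiN.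
  pose a i := a_num p q (d i); pose b i := b_num p q (d i).
  rewrite /W (@weighted_count F algC _ psiP T d l N m d_inj d_gt0 l_lt m_lt
    (fun i k => b i + a i * q%:R *+ (p %| k)%N)
    (fun i => AB_series N p q (a i) (b i))
    (fun i => AB_series N p q (- a i) (- b i)) 1).
  - congr ratr; rewrite coef_prod_ffun //; apply: eq_bigr => k _; congr (_ * _).
    apply: eq_bigr => i _; rewrite -coef_B // -coef_A // ?mulrA //.
    exact: leq_trans m_lt.
  - move=> i k; rewrite /a /b -card_F.
    by apply: (@psum_nontrivial F algC p e) => //; rewrite card_F.
  - by move=> i; exact: newton_AB.
  - move=> i.
    apply: newton_eqX (newton_AB q p_gt0 (- a i) (- b i) N0) => k ltkN.
    by rewrite coefN !coef_poly ltkN mulNr !mulNrn -opprD mulNrn.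
  - move=> k ltkN; rewrite rmorph1 coef1 coef_poly ltkN.
    exact: sum_chi_nontrivial psic.
(* Orthogonality selects the polynomials with subleading coefficient alpha, each with weight q. *)
have main : q%:R * (Nstar m l alpha)%:R
    = \sum_i addchar i (- alpha) * W (@addchar F i) :> algC.
  rewrite Nstar_sum // mulr_sumr /W.
  under [RHS]eq_bigr do rewrite mulr_sumr.
  rewrite exchange_big /=; apply: eq_bigr => f _.
  under [RHS]eq_bigr do rewrite mulrCA [_ * chi _ _]mulrC.
  rewrite -mulr_sumr addchar_orthogonality card_F.
  by case: (subcoef f == alpha); rewrite ?mulr0n ?mulr0 // !mulr1n mulrC.
have sum_addchar : \sum_(i | i != 0) addchar i (- alpha) = ratr (v q alpha).
  (* At the pair 0, alpha every psi(0) is 1, and removing the trivial character subtracts 1. *)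
  have := addchar_orthogonality 0 alpha.
  rewrite (bigD1 0) //= !addchar0 mulr1 => /(canRL (addKr _)) e1.
  rewrite (eq_bigr (fun i => addchar i 0 * addchar i (- alpha))); last first.
    by move=> i _; rewrite (additive_char0 (addcharP i)) mul1r.
  rewrite e1 card_F /v rmorphB rmorph1 rmorphM !rmorph_nat mulr_natr addrC.
  by rewrite eq_sym.
(* The rational identity is multiplied by q and checked in [algC], where the characters take their
   values. *)
apply: (mulfI q0); apply: (fmorph_inj (@ratr algC)).
rewrite rmorphM !rmorph_nat main (bigD1 0) //= addchar0 mul1r W_trivial.
rewrite (eq_bigr (fun i => addchar i (- alpha) * ratr S1)); last first.
  by move=> i i0; rewrite W_nontrivial //; exact: addchar_nontrivial.
rewrite -mulr_suml sum_addchar -rmorphM -rmorphD; congr ratr.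
rewrite mulrDr -{1}(prednK m_gt0) exprS -mulrA; congr (_ + _).
by field.
Qed.
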